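(* Let $\Delta(n)$ be the set of $DIII$ $(n,n)$-clans, and let $A_n(t)=\sum_{\gamma\in\Delta(n)}t^{L(\gamma)}$ be its length generating function, i.e. the rank polynomial of the weak order poset on $DIII$ $(n,n)$-clans. Then for all $n\ge 3$, $$A_n(t)=2A_{n-1}(t)+\left(t+t^2+\cdots+t^{n-2}+2t^{n-1}+t^n+\cdots+t^{2n-3}\right)A_{n-2}(t).$$
   Context: Clans. An $(n,n)$-clan ($n\ge1$) is a string $\gamma=c_1\cdots c_{2n}$ of symbols from $\mathbb N\cup\{+,-\}$ with equally many $+$'s and $-$'s, in which every natural number that appears appears exactly twice; two clans are equal if they have the same signs at the same positions and the same positions of matching number pairs. $rev(\gamma)=c_{2n}\cdots c_1$, and $\overline\gamma$ is obtained by exchanging $+$ and $-$. A $DIII$ $(n,n)$-clan is an $(n,n)$-clan such that (i) $\gamma=rev(\overline\gamma)$; (ii) if $c_i\in\mathbb N$ then $c_i\ne c_{2n+1-i}$; (iii) the number of $-$'s among $c_1,\dots,c_n$ plus the number of pairs $i<j\le n$ with $c_i=c_j\in\mathbb N$ is even. The underlying involution $\sigma_\gamma\in\mathcal S_{2n}$ exchanges $i$ and $j$ when $c_i=c_j\in\mathbb N$, $i\neq j$, and fixes the positions of signs. A clan is matchless if it contains no natural numbers. Weak order. Let $n\ge2$ and let $W\subset\mathcal S_{2n}$ be the Coxeter group of type $D_n$ generated by the simple reflections $s_i=(i\ \ i{+}1)(2n{-}i\ \ 2n{+}1{-}i)$ for $1\le i\le n-1$ and $s_n=(n\ \ n{+}2)(n{-}1\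 \ n{+}1)$. The simple reflections act on $DIII$ $(n,n)$-clans as follows. Suppose $s_i\sigma_\gamma$ is longer than $\sigma_\gamma$ (Coxeter length in $W$). (1) If $s_i\sigma_\gamma s_i\ne\sigma_\gamma$, then $s_i\cdot\gamma$ is obtained by permuting the symbols of $\gamma$ by $s_i$. (2) If $s_i\sigma_\gamma s_i=\sigma_\gamma$, $1\le i\le n-1$, and $c_i,c_{i+1}$ are opposite signs, then $s_i\cdot\gamma$ is obtained by replacing $c_i,c_{i+1}$ by a matching pair of natural numbers and $c_{2n-i},c_{2n+1-i}$ by another matching pair. (3) If $i=n$ and $c_{n-1}c_nc_{n+1}c_{n+2}$ is ${+}{+}{-}{-}$ or ${-}{-}{+}{+}$, then $s_n\cdot\gamma$ is obtained by replacing these four symbols by the pattern $abab$ with $a\neq b$ new natural numbers. In all other cases $s_i\cdot\gamma=\gamma$. (This describes the dense $B$-orbit in $P_{s_i}\cdot R_\gamma$ for the $B$-orbit $R_\gamma$ of $SO_{2n}/GL_n$ indexed by $\gamma$.) The weak order is the transitive closure of the relations $\gamma\prec\gamma'$ whenever $\gamma'=s_i\cdot\gamma\ne\gamma$ for some $i$. For $n=1$ there are no simple reflections and the only $DIII$ clan is ${+}{-}$. Length. The weak order is graded, with minimal elements the matchless clans, in rank $0$. $L(\gamma)$ is the rank of $\gamma$: $L(\gamma)=k$ if $\gamma=s_{i_k}\cdot(\cdots(s_{i_1}\cdot\gamma_0)\cdots)$ with $\gamma_0$ matchless and with each of the $k$ successive actions changing the clan ($k$ is independent of choices). *)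

(* Defs.v *)
From mathcomp Require Import all_boot all_order all_algebra all_fingroup.

Set Implicit Arguments.
Unset Strict Implicit.
Unset Printing Implicit Defensive.

Import GRing.Theory.

Local Open Scope nat_scope.

(* Position p of a string c_1 ... c_2n is the ordinal of value p - 1.         *)
Notation position n := 'I_(n + n).

(* Natural-number symbols only matter through which positions carry the same  *)
(* number, so the number at p is recorded as the position of its other        *)
(* occurrence. Two clans are thus equal exactly when they have the same signs *)
(* and the same matching pairs at the same positions.                         *)
Notation symbol n := (sum bool (position n)).
Notation string n := {ffun position n -> symbol n}.

Definition plus n : symbol n := inl true.
Definition minus n : symbol n := inl false.
Arguments plus {n}.
Arguments minus {n}.

Section Clans.
Variable n : nat.
Implicit Types (c : string n) (p q : position n).

Definition is_clan c : bool :=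
  [forall p, if c p is inr q then (q != p) && (c q == inr p) else true]
  && (#|[set p | c p == plus]| == #|[set p | c p == minus]|).

(* For an involution f, the symbol at p is moved to f p; since numbers are    *)
(* recorded by partner positions, these move too.                             *)
Definition permute (f : position n -> position n) c : string n :=
  [ffun p => match c (f p) with inl b => inl b | inr q => inr (f q) end].

Definition rev_clan c : string n := permute (@rev_ord (n + n)) c.

Definition bar_clan c : string n :=
  [ffun p => match c p with inl b => inl (~~ b) | inr q => inr q end].

Definition left_half (i : 'I_n) : position n := lshift n i.

Definition is_DIII c : bool :=
  [&& is_clan c,
      c == rev_clan (bar_clan c),
      [forall p, c p != inr (rev_ord p)] &
      ~~ odd (#|[set i : 'I_n | c (left_half i) == minus]|
              + #|[set ij : 'I_n * 'I_n | (ij.1 < ij.2)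
                     && (c (left_half ij.1) == inr (left_half ij.2))]|)].

Definition Delta : {set string n} := [set c | is_DIII c].

Definition matchless c : bool := [forall p, if c p is inr _ then false else true].

Definition partner c p : position n := if c p is inr q then q else p.

(* The default value 1 is not used on clans: see [underlyingE].               *)
Definition underlying c : 'S_(n + n) := insubd (1%g : 'S_(n + n)) (finfun (partner c)).

Lemma underlyingE c p : is_clan c -> underlying c p = partner c p.
Proof.
case/andP=> /forallP cP _.
have pK : involutive (partner c).
  move=> x; rewrite /partner; case cx: (c x) => [b|y]; first by rewrite cx.
  by have := cP x; rewrite cx => /andP[_ /eqP->].
have inj : injectiveb (finfun (partner c)).
  by apply/injectiveP => x y; rewrite !ffunE; apply: (can_inj pK).
by rewrite -pvalE /underlying /insubd insubT /= ffunE.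
Qed.

(* [simple i] is s_(i+1): the last index gives the branching reflection s_n.  *)
(* When n = 1 there is no simple reflection; [simple] is then the identity    *)
(* (as [ord_pred i = i]) and affects neither lengths nor the action.          *)
Definition simple (i : 'I_n) : 'S_(n + n) :=
  if i.+1 < n then
    let p := left_half i in let q := left_half (ordS i) in
    (tperm p q * tperm (rev_ord q) (rev_ord p))%g
  else
    let p := left_half (ord_pred i) in let q := left_half i in
    (tperm q (rev_ord p) * tperm p (rev_ord q))%g.

(* The least k satisfying P, provided there is one below b.                   *)
Definition least (b : nat) (P : pred nat) : nat := find P (iota 0 b).

(* Word length in the simple reflections. A shortest word has pairwise        *)
(* distinct partial products, so the bound is never reached on the group they *)
(* generate.                                                                  *)
Definition coxeter_length (w : 'S_(n + n)) : nat :=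
  least #|{: 'S_(n + n)}|
    (fun k => [exists u : k.-tuple 'I_n, (\prod_(i <- u) simple i)%g == w]).

Definition match_pair p q c : string n :=
  [ffun r => if r == p then inr q else if r == q then inr p else c r].

(* Permutations compose from left to right in the library; since the          *)
(* underlying permutation of a clan is an involution, its products with a     *)
(* simple reflection on either side are inverse to each other and have the    *)
(* same length.                                                               *)
Definition act (i : 'I_n) c : string n :=
  let s := simple i in
  let sigma := underlying c in
  if coxeter_length sigma < coxeter_length (s * sigma)%g then
    if (s * sigma * s)%g != sigma then permute s c
    else if i.+1 < n then
      let p := left_half i in let q := left_half (ordS i) in
      if ((c p == plus) && (c q == minus)) || ((c p == minus) && (c q == plus))
      then match_pair p q (match_pair (rev_ord q) (rev_ord p) c)
      else c
    else
      let p := left_half (ord_pred i) in let q := left_half i in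
      let block := [:: c p; c q; c (rev_ord q); c (rev_ord p)] in
      if (block == [:: plus; plus; minus; minus])
         || (block == [:: minus; minus; plus; plus])
      then match_pair p (rev_ord q) (match_pair q (rev_ord p) c)
      else c
  else c.

Definition covers c c' : bool := [exists i, (act i c == c') && (c' != c)].

(* [has_length k c]: c is reached from a matchless DIII clan by k successive  *)
(* actions, each of which changes the clan.                                   *)
Fixpoint has_length (k : nat) c : bool :=
  if k is k'.+1 then [exists c0, has_length k' c0 && covers c0 c]
  else (c \in Delta) && matchless c.

(* The weak order being graded, at most one k satisfies [has_length k c].     *)
Definition L c : nat := least #|{: string n}| (fun k => has_length k c).

Definition A : {poly int} := (\sum_(c in Delta) 'X^(L c))%R.

End Clans.

(* Main.v *)
Require Import Defs.
From mathcomp Require Import all_boot all_order all_algebra all_fingroup.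
From mathcomp Require Import zify.

(** The rank of a clan [c] with involution [sigma] is (l(sigma) + a)/2, where l
    is the Coxeter length of type D and 2a is the number of matched pairs: a
    conjugation step of the weak order adds 2 to l, a matching step adds 1 to
    both l and a. Since l is half the number of pairs x < y with y not opposite
    to x that sigma inverts, the rank can be read off the clan.

    Sort the clans by their first symbol. If it is a sign, deleting the first
    and last symbols keeps the rank and leaves a clan of size n - 1; the parity
    in condition (iii) changes with the sign, but conjugation by the
    transposition of the two middle positions exchanges the two parities and
    keeps the rank. If the first symbol is matched to position j, each simple
    reflection moving j to the right gives a rank-raising bijection; the
    branching one jumps over the middle, so that both middle positions are
    reached at the same rank, whence the coefficient 2. The chain starts with
    j = 2, where unmatching gives the clans that start with +- at one rank
    less, and these come from the clans of size n - 2. *)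

Set Implicit Arguments.
Unset Strict Implicit.
Unset Printing Implicit Defensive.
Local Open Scope nat_scope.

(** * Signed positions and simple roots *)

Section Roots.
Variable n : nat.
Implicit Types (x y z p q : position n) (i : 'I_n).

Lemma rev_ord_neq p : rev_ord p != p.
Proof. by rewrite -val_eqE /=; have := ltn_ord p; lia. Qed.

(* Opposite positions are not compared: they do not span a root of type D. *)
Definition prec x y := (x < y) && (y != rev_ord x).

Lemma precE x y : prec x y = (x < y) && (x + y.+1 != n + n).
Proof.
rewrite /prec -val_eqE /=; have := ltn_ord x; have := ltn_ord y; lia.
Qed.

Lemma prec_rev x y : prec (rev_ord x) (rev_ord y) = prec y x.
Proof. rewrite !precE /=; have := ltn_ord x; have := ltn_ord y; lia. Qed.

Lemma prec_asym x y : prec x y -> prec y x = false.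
Proof. rewrite !precE; lia. Qed.

Lemma prec_total x y : y != x -> y != rev_ord x -> ~~ prec x y -> prec y x.
Proof.
rewrite !precE -!val_eqE /=; have := ltn_ord x; have := ltn_ord y; lia.
Qed.

(* [simple i] exchanges [src i] with [tgt i] and their mirror images. Taking
   the positions n - 1 and n + 1 for the branching reflection makes cases (2)
   and (3) of the action the same rule: opposite signs at [src i] and [tgt i]
   are replaced by a matching pair, and so are their mirror images. *)
Definition src i := if i.+1 < n then left_half i else left_half (ord_pred i).
Definition tgt i :=
  if i.+1 < n then left_half (ordS i) else rev_ord (left_half i).

Definition swap p q x :=
  if x == p then q else if x == q then p
  else if x == rev_ord p then rev_ord q
  else if x == rev_ord q then rev_ord p else x.

Hypothesis n_gt1 : 1 < n.

(** Positions count from 0, so the branching root joins the values [n - 2] and [n], the latter being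
    the mirror image of [n - 1]. *)
Lemma root_val i :
  [/\ i.+1 < n, src i = i :> nat & tgt i = i.+1 :> nat] \/
  [/\ i.+1 = n, src i = n - 2 :> nat & tgt i = n :> nat].
Proof.
rewrite /src /tgt; case: ifP => lt_in /=.
  by left; split=> //; rewrite modn_small.
have := ltn_ord i => i_n; have i_eq : i.+1 = n by lia.
right; split=> //; last lia.
rewrite (_ : (i + n).-1 = n - 2 + n) ?modnDr ?modn_small //; first lia.
by move: (nat_of_ord i) i_eq => m m_n; lia.
Qed.

Lemma prec_root i : prec (src i) (tgt i).
Proof. by rewrite precE; have [[? -> ->]|[? -> ->]] := root_val i; lia. Qed.

Lemma root_uniq i :
  uniq [:: src i; tgt i; rev_ord (tgt i); rev_ord (src i)].
Proof.
rewrite /= !inE -!val_eqE /=.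
have [[? -> ->]|[? -> ->]] := root_val i; lia.
Qed.

Lemma simpleE i x : simple i x = swap (src i) (tgt i) x.
Proof.
have := root_uniq i; rewrite /simple /src /tgt /swap.
unlock tperm; case: ifP => _; rewrite !permE /= !permE /= ?rev_ordK;
  rewrite /= !inE !negb_or; do ![case: (x =P _) => //= ?];
  do ![case: eqP => //= ?]; move=> *; congruence.
Qed.

Lemma simple_src i : simple i (src i) = tgt i.
Proof. by rewrite simpleE /swap eqxx. Qed.

Lemma simple_rev i x : simple i (rev_ord x) = rev_ord (simple i x).
Proof.
rewrite !simpleE /swap !(inj_eq rev_ord_inj) -!(inv_eq rev_ordK).
have := root_uniq i; rewrite /= !inE !negb_or.
by do ![case: eqP => //= ?]; move=> *; subst; rewrite ?rev_ordK //; congruence.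
Qed.

Lemma simpleK i : involutive (simple i).
Proof.
move=> x; rewrite !simpleE /swap; have := root_uniq i; rewrite /= !inE !negb_or.
do ![case: (x =P _) => //= ?];
by do ![case: eqP => //= ?]; move=> *; subst; rewrite ?rev_ordK //; congruence.
Qed.

Lemma simple_tgt i : simple i (tgt i) = src i.
Proof. by rewrite -simple_src simpleK. Qed.

(** The simple root and its negative, each in its two mirror forms. *)
Definition root_pairs i :=
  [:: (src i, tgt i); (tgt i, src i); (rev_ord (tgt i), rev_ord (src i));
      (rev_ord (src i), rev_ord (tgt i))].

Lemma simple_val i x : simple i x = (
  if x == src i :> nat then (tgt i : nat) else
  if x == tgt i :> nat then (src i : nat) else
  if x == rev_ord (src i) :> nat then (rev_ord (tgt i) : nat) else
  if x == rev_ord (tgt i) :> nat then (rev_ord (src i) : nat) else x) :> nat.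
Proof. by rewrite simpleE /swap -!val_eqE /=; do ![case: ifP => // _]. Qed.

(** A simple reflection permutes the positive roots other than its own. *)
Lemma prec_simple i x y :
  (x, y) \notin root_pairs i -> prec (simple i x) (simple i y) = prec x y.
Proof.
have ord_eqE (a b : position n) : (a == b) = (a == b :> nat) by rewrite -val_eqE.
rewrite !inE !xpair_eqE !precE !simple_val !ord_eqE.
have [r_sum t_sum] : rev_ord (tgt i) + (tgt i).+1 = n + n
                    /\ rev_ord (src i) + (src i).+1 = n + n.
  by rewrite /= !subnK.
(* Either the root joins two neighbours in the left half, or it jumps over [rev_ord (tgt i)]; the
   rest is linear arithmetic in the four values. *)
have ineqs : [\/ [/\ (tgt i = (src i).+1 :> nat), tgt i < n & tgt i < rev_ord (tgt i)]
   | [/\ (rev_ord (tgt i) = (src i).+1 :> nat), tgt i = n :> nat & n = (src i).+2]].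
  by have [[? e f]|[? e f]] := root_val i; rewrite /= f e; [left|right]; split; lia.
have := ltn_ord x; have := ltn_ord y.
move: (nat_of_ord x) (nat_of_ord y) r_sum t_sum ineqs.
move: (nat_of_ord (src i)) (nat_of_ord (tgt i)) (nat_of_ord (rev_ord (src i)))
  (nat_of_ord (rev_ord (tgt i))) => p q p' q' x' y' /=.
move: (n + n) => m e1 e2; case=> [[f1 f2 f3]|[f1 f2 f3]]; subst.
  do ![case: (x' =P _) => ?]; do ![case: (y' =P _) => ?]; subst; lia.
do ![case: (x' =P _) => ?]; do ![case: (y' =P _) => ?]; subst; lia.
Qed.

End Roots.

(** * Inversions and Coxeter length *)

Section Inversions.
Variable n : nat.
Implicit Types (x y z p q : position n) (i : 'I_n) (f : position n -> position n).

(** The permutations with this property form the Coxeter group of type B; the even ones among them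
    form the group of type D. *)
Definition rev_equiv f := forall x, f (rev_ord x) = rev_ord (f x).

Definition dinv f : nat :=
  \sum_(u : position n * position n) (prec u.1 u.2 && prec (f u.2) (f u.1)).

Lemma eq_dinv f g : f =1 g -> dinv f = dinv g.
Proof. by move=> fg; apply: eq_bigr => u _; rewrite !fg. Qed.

Lemma dinv_perm0 : dinv (1%g : 'S_(n + n)) = 0.
Proof.
rewrite /dinv big1 // => -[x y] _ /=; rewrite !perm1.
by case: (boolP (prec x y)) => // /prec_asym ->.
Qed.

(** The map [(x, y) -> (g y, g x)] carries the inversions of [g] to those of [f]. *)
Lemma dinv_can f g : cancel f g -> cancel g f -> dinv f = dinv g.
Proof.
move=> fK gK; pose h (u : position n * position n) := (g u.2, g u.1).
have h_bij : bijective h.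
  by exists (fun u => (f u.2, f u.1)) => -[x y]; rewrite /h /= ?fK ?gK.
by rewrite /dinv (reindex h) /=; [apply: eq_bigr => u _; rewrite !gK andbC|apply: onW_bij].
Qed.

Hypothesis n_gt1 : 1 < n.

Lemma sum_root_pairs i (F : position n * position n -> nat) :
  \sum_u F u = F (src i, tgt i) + F (tgt i, src i)
    + F (rev_ord (tgt i), rev_ord (src i)) + F (rev_ord (src i), rev_ord (tgt i))
    + \sum_(u | u \notin root_pairs i) F u.
Proof.
rewrite (bigID (mem (root_pairs i))) /= -[X in X + _ = _]big_uniq /=.
  by rewrite !big_cons big_nil !addnA addn0.
have := root_uniq n_gt1 i; rewrite /= !inE !xpair_eqE !negb_or !andbT.
rewrite ![_ == src i]eq_sym ![_ == tgt i]eq_sym ![_ == rev_ord (tgt i)]eq_sym.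
by do ![case: eqP => //= ?].
Qed.

(** Only the pairs in [root_pairs] can change status, and the two mirror copies give the factor 2.
    Corrections on both sides treat ascents and descents together without subtraction. *)
Lemma dinv_simple i f : injective f -> rev_equiv f ->
  dinv (f \o simple i) + 2 * prec (f (tgt i)) (f (src i))
    = dinv f + 2 * prec (f (src i)) (f (tgt i)).
Proof.
move=> f_inj f_rev; pose h (u : position n * position n) := (simple i u.1, simple i u.2).
have hK : involutive h by case=> x y; rewrite /h /= !simpleK.
rewrite /dinv (reindex h) /=; last by apply: onW_bij; exists h.
rewrite !(sum_root_pairs i) /= !simpleK // !simple_rev // !simple_src // !simple_tgt //.
rewrite !f_rev !prec_rev (prec_root n_gt1) (prec_asym (prec_root n_gt1 i)) /=.
under eq_bigr => u u_roots do rewrite !simpleK // prec_simple // -?surjective_pairing //.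
lia.
Qed.

(** The ordinary simple roots make [f] increasing on the left half, mirror symmetry does so on the
    right half, and the branching root links the halves. *)
Lemma no_descent f : rev_equiv f -> injective f ->
  (forall i, prec (f (src i)) (f (tgt i))) ->
  forall x y, prec x y -> prec (f x) (f y).
Proof.
move=> f_rev f_inj asc.
have ascl i x y : src i = x :> nat -> tgt i = y :> nat -> f x < f y.
  by move=> /val_inj <- /val_inj <-; case/andP: (asc i).
have left_incr d x y : y = x + d.+1 :> nat -> y < n -> f x < f y.
  elim: d y => [|d IHd] y y_eq y_n.
    have x_n : x < n by lia.
    by apply: (ascl (Ordinal x_n));
      have [[/= ? e1 e2]|[/= ? e1 e2]] := root_val n_gt1 (Ordinal x_n);
      rewrite ?e1 ?e2; lia.
  have z_n : x + d.+1 < n by lia.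
  have := IHd (left_half (Ordinal z_n)) erefl z_n => /ltn_trans; apply.
  by apply: (ascl (Ordinal z_n));
    have [[/= ? e1 e2]|[/= ? e1 e2]] := root_val n_gt1 (Ordinal z_n);
      rewrite ?e1 ?e2 /=; lia.
have incr x y : x < y -> (y < n) || (n <= x) -> f x < f y.
  move=> lt_xy /orP[y_n|n_x]; first by apply: (@left_incr (y - x.+1)); lia.
  have := ltn_ord x; have := ltn_ord y => y_m x_m.
  have := @left_incr (y - x.+1) (rev_ord y) (rev_ord x); rewrite !f_rev /=.
  have := ltn_ord (f x); have := ltn_ord (f y); lia.
have last_n : n.-1 < n by lia.
have cross : f (src (Ordinal last_n)) < f (tgt (Ordinal last_n)).
  by case/andP: (asc (Ordinal last_n)).
have [[/=]|[/= _ e1 e2]] := root_val n_gt1 (Ordinal last_n); first lia.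
move: e1 e2 cross; set a := src _; set b := tgt _ => a_eq b_eq cross.
have cross' : f (rev_ord b) < f (rev_ord a).
  rewrite !f_rev /=; have := ltn_ord (f a); have := ltn_ord (f b); lia.
move=> x y; rewrite /prec => /andP[lt_xy y_x]; apply/andP; split; last first.
  by rewrite -f_rev (inj_eq f_inj).
case: (boolP ((y < n) || (n <= x))) => [|]; first exact: incr.
rewrite negb_or -leqNgt -ltnNge => /andP[n_y x_n].
have leq_f u v : u = v \/ f u < f v -> f u <= f v by case=> [->|/ltnW].
(* A pair across the middle goes through [a] and [b], of values [n - 2] and [n], if [x] is at most
   [a]. Otherwise [x] is [n - 1], and since [y] is not its mirror [n], the path through [rev_ord b]
   and [rev_ord a] applies. *)
have [x_a|x_a] := leqP x (n - 2).
  have xa : f x <= f a.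
    apply: leq_f; have [e|e] := eqVneq (x : nat) a; [left; exact: val_inj|right].
    by apply: incr; lia.
  have yb : f b <= f y.
    apply: leq_f; have [e|e] := eqVneq (b : nat) y; [left; exact: val_inj|right].
    by apply: incr; lia.
  by apply: leq_ltn_trans xa (leq_trans cross yb).
have x_b : x = rev_ord b by apply: val_inj => /=; lia.
have ya : f (rev_ord a) <= f y.
  apply: leq_f; have [e|e] := eqVneq (rev_ord a : nat) y; [left; exact: val_inj|right].
  apply: incr; last by rewrite /= a_eq; lia.
  move: y_x e; rewrite x_b rev_ordK -val_eqE /=; move: (ltn_ord y); lia.
by rewrite x_b; apply: leq_trans ya.
Qed.

(** The number of successors determines [x], except that the two middle positions have equally many:
    the term [x < n] accounts for the excluded opposite position. *)
Lemma card_prec x : #|[pred y | prec x y]| + (x < n) + x.+1 = n + n.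
Proof.
have gt_x : #|[pred y : position n | x < y]| + x.+1 = n + n.
  have card_le : #|[pred y : position n | y < x.+1]| = x.+1.
    rewrite -sum1_card (eq_bigl (fun y : position n => y < x.+1)) //.
    by rewrite (big_ord_narrow (ltn_ord x)) sum1_card card_ord.
  rewrite -[RHS]card_ord -(cardC [pred y : position n | y < x.+1]) card_le addnC.
  by congr (_ + _); apply: eq_card => y; rewrite !inE -leqNgt.
rewrite -[RHS]gt_x; congr (_ + _).
rewrite -[RHS](cardID (pred1 (rev_ord x))) addnC; congr (_ + _); last first.
  by apply: eq_card => y; rewrite !inE /prec andbC.
have -> : x < n = (x < rev_ord x) by rewrite /=; have := ltn_ord x; lia.
case: (boolP (x < rev_ord x)) => lt_x.
  rewrite -[LHS](card1 (rev_ord x)); apply: eq_card => y.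
  by rewrite !inE andbC; case: eqP => // ->.
apply/esym/eqP; rewrite /= eqn0Ngt; apply/card_gt0P => -[y]; rewrite !inE.
by case/andP=> lt_xy /eqP y_x; rewrite -y_x lt_xy in lt_x.
Qed.

(** [w] preserves [prec], hence numbers of successors, so it can at most exchange the two middle
    positions, and that transposition is odd. *)
Lemma no_descent_perm (w : 'S_(n + n)) : rev_equiv w ->
  (forall i, prec (w (src i)) (w (tgt i))) -> ~~ odd_perm w -> w = 1%g.
Proof.
move=> w_rev asc w_even; have w_inj : injective w := @perm_inj _ w.
have precw x y : prec (w x) (w y) = prec x y.
  apply/idP/idP; last exact: no_descent.
  move=> wxy; apply: contraLR (wxy) => /prec_total nyx; rewrite (prec_asym _) //.
  apply: (no_descent w_rev w_inj asc); apply: nyx; apply: contraTneq wxy => ->.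
    by rewrite precE ltnn.
  by rewrite /prec w_rev eqxx andbF.
have card_w x : #|[pred y | prec (w x) y]| = #|[pred y | prec x y]|.
  rewrite -(card_image w_inj [pred y | prec x y]); apply: eq_card => y; rewrite !inE.
  by rewrite -{2}(permKV w y) mem_image // inE -{1}(permKV w y) precw.
have w_val x : w x = x \/ w x = rev_ord x.
  have := card_prec x; have := card_prec (w x); rewrite card_w.
  case: (ltnP x n); case: (ltnP (w x) n) => wx_n x_n e1 e2.
  - by left; apply: val_inj; move: e1 e2 => /=; lia.
  - by right; apply: val_inj; move: e1 e2 => /=; lia.
  - by right; apply: val_inj; move: e1 e2 => /=; lia.
  by left; apply: val_inj; move: e1 e2 => /=; lia.
have last_n : n.-1 < n by lia.
pose z := left_half (Ordinal last_n).
have w_z x : x != z -> x != rev_ord z -> w x = x.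
  move=> x_z x_rz; have [//|wx] := w_val x.
  have := card_prec x; have := card_prec (w x); rewrite card_w wx.
  have := ltn_ord x; move: x_z x_rz; rewrite -!val_eqE /=.
  case: (ltnP x n) => x_n; lia.
have [wz|wz] := w_val z.
  apply/permP => x; rewrite perm1; have [->//|x_z] := eqVneq x z.
  by have [->|] := eqVneq x (rev_ord z); [rewrite w_rev wz|exact: w_z].
move: w_even; have -> : w = tperm z (rev_ord z).
  apply/permP => x; case: tpermP => [->//|->|/eqP ? /eqP]; last exact: w_z.
  by rewrite w_rev wz rev_ordK.
by rewrite odd_tperm eq_sym rev_ord_neq.
Qed.

Lemma odd_simple i : odd_perm (simple i) = false.
Proof.
have := root_uniq n_gt1 i; rewrite /simple /src /tgt /= !inE !negb_or.
case: ifP => _; rewrite odd_permM !odd_tperm ?rev_ordK;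
  by do ![case: eqP => //= ?]; move=> *; congruence.
Qed.

(* [dinv] counts an inverted pair (x, y) and its mirror image
   (rev y, rev x) separately, hence the factor 2. *)
Lemma dinv_word (w : 'S_(n + n)) : rev_equiv w -> ~~ odd_perm w ->
  exists2 u : seq 'I_n, (\prod_(i <- u) simple i)%g = w & dinv w = 2 * size u.
Proof.
have [k] := ubnP (dinv w); elim: k w => // k IHk w le_k w_rev w_even.
have [/forallP asc|] := boolP [forall i, prec (w (src i)) (w (tgt i))].
  rewrite (no_descent_perm w_rev asc w_even) dinv_perm0.
  by exists [::]; rewrite ?big_nil.
rewrite negb_forall => /existsP[i desc].
have := prec_root n_gt1 i; have := dinv_simple i (@perm_inj _ w) w_rev.
rewrite (negbTE desc) addn0 => dinv_w root_i.
have desc' : prec (w (tgt i)) (w (src i)).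
  apply: prec_total; rewrite // -?w_rev (inj_eq perm_inj).
    by apply: contraTneq root_i => ->; rewrite precE ltnn.
  by apply: contraTneq root_i => ->; rewrite /prec eqxx andbF.
have dinv_sw : dinv (simple i * w)%g + 2 = dinv w.
  by rewrite -[RHS]dinv_w desc'; congr (_ + _); apply: eq_dinv => x; rewrite permM.
have [|||u u_prod u_size] := IHk (simple i * w)%g; first lia.
- by move=> x; rewrite !permM simple_rev.
- by rewrite odd_permM odd_simple.
exists (i :: u); last by rewrite /=; lia.
have ss : (simple i * simple i)%g = 1%g by apply/permP => x; rewrite permM perm1 simpleK.
by rewrite big_cons u_prod mulgA ss mul1g.
Qed.

Lemma prod_rev (u : seq 'I_n) : rev_equiv (\prod_(i <- u) simple i)%g.
Proof.
elim: u => [|i u IHu] x; first by rewrite big_nil !perm1.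
by rewrite big_cons !permM simple_rev.
Qed.

(** Each letter raises the count by at most 2. *)
Lemma dinv_prod (u : seq 'I_n) : dinv (\prod_(i <- u) simple i)%g <= 2 * size u.
Proof.
elim: u => [|i u IHu]; first by rewrite big_nil dinv_perm0.
rewrite big_cons /=; set w := (\prod_(_ <- _) _)%g in IHu *.
have := dinv_simple i (@perm_inj _ w) (@prod_rev u).
rewrite (@eq_dinv (w \o simple i) (simple i * w)%g) => [|x]; last by rewrite permM.
by case: prec; case: prec => /=; lia.
Qed.

Lemma dinv_leq f : dinv f <= (n + n) * (n + n).-1.
Proof.
rewrite /dinv -(pair_bigA _ (fun x y => prec x y && prec (f y) (f x) : nat)) /=.
rewrite -[X in _ <= X * _](card_ord (n + n)) -sum_nat_const; apply: leq_sum => x _.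
rewrite -[X in _ <= X](etrans (cardC1 x) (congr1 predn (card_ord (n + n)))).
rewrite -sum1_card [leqRHS]big_mkcond.
apply: leq_sum => y _; rewrite !inE /prec; case: (eqVneq y x) => [->|_].
  by rewrite ltnn.
exact: leq_b1.
Qed.

(** Ensures that the search defining [coxeter_length] succeeds before its cut-off. *)
Lemma dinv_bound f : dinv f < 2 * #|{: 'S_(n + n)}|.
Proof.
have -> : #|{: 'S_(n + n)}| = (n + n)`!.
  rewrite -[X in X`!](card_ord (n + n)) -(cardsT (position n)) -card_perm.
  by apply: eq_card => w; rewrite !inE; apply/esym/subsetP => x _; rewrite inE.
apply: leq_ltn_trans (dinv_leq f) _.
have -> : n + n = (n + n).-2.+2 by lia.
by rewrite 2!factS mulnA mul2n -addnn; have := fact_gt0 (n + n).-2; nia.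
Qed.

(** [dinv_word] supplies a word of the required size and [dinv_prod] excludes shorter ones. *)
Lemma coxeter_lengthE (w : 'S_(n + n)) : rev_equiv w -> ~~ odd_perm w ->
  dinv w = 2 * coxeter_length w.
Proof.
move=> w_rev w_even; have [u u_prod u_size] := dinv_word w_rev w_even.
rewrite u_size; congr (2 * _); rewrite /coxeter_length /least.
set P := (X in find X); set b := #|_|.
have lt_ub : size u < b by have := dinv_bound w; rewrite u_size -/b; lia.
have Pu : P (size u) by apply/existsP; exists (in_tuple u); apply/eqP.
have P_ge k : P k -> size u <= k.
  case/existsP=> v /eqP v_prod; have := dinv_prod v.
  by rewrite v_prod u_size size_tuple; lia.
have hasP : has P (iota 0 b).
  by apply/hasP; exists (size u); rewrite ?mem_iota.
apply/eqP; rewrite eqn_leq; apply/andP; split.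
  apply: P_ge; have := nth_find 0 hasP.
  by rewrite nth_iota // -[X in _ < X](size_iota 0) -has_find.
rewrite leqNgt; apply/negP => /(before_find 0).
by rewrite nth_iota ?Pu.
Qed.

End Inversions.

(** * Symmetric clans and their parity *)

Section SymmetricClans.
Variable n : nat.
Implicit Types (c : string n) (x y z p q : position n) (i : 'I_n).
Implicit Types (f : position n -> position n) (b : bool).

Definition symclan c := [forall p, match c p with
  | inl b => c (rev_ord p) == inl (~~ b)
  | inr q => [&& q != p, q != rev_ord p, c q == inr p
                & c (rev_ord p) == inr (rev_ord q)]
  end].

Lemma sym_sign c p b : symclan c -> c p = inl b -> c (rev_ord p) = inl (~~ b).
Proof. by move=> /forallP/(_ p) + cp; rewrite cp => /eqP. Qed.

Lemma sym_pair c p q : symclan c -> c p = inr q ->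
  [/\ q != p, q != rev_ord p, c q = inr p & c (rev_ord p) = inr (rev_ord q)].
Proof. by move=> /forallP/(_ p) + cp; rewrite cp => /and4P[? ? /eqP ? /eqP]. Qed.

Lemma partnerK c : symclan c -> involutive (partner c).
Proof.
move=> c_sym p; rewrite /partner; case cp: (c p) => [b|q]; first by rewrite cp.
by have [_ _ ->] := sym_pair c_sym cp.
Qed.

Lemma partner_rev c : symclan c -> rev_equiv (partner c).
Proof.
move=> c_sym p; rewrite /partner; case cp: (c p) => [b|q].
  by rewrite (sym_sign c_sym cp).
by have [_ _ _ ->] := sym_pair c_sym cp.
Qed.

Lemma partner_neq_rev c p : symclan c -> partner c p != rev_ord p.
Proof.
move=> c_sym; rewrite /partner; case cp: (c p) => [b|q].
  by rewrite eq_sym rev_ord_neq.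
by have [] := sym_pair c_sym cp.
Qed.

Lemma symclan_is_clan c : symclan c -> is_clan c.
Proof.
move=> c_sym; apply/andP; split.
  apply/forallP => p; case cp: (c p) => [//|q].
  by have [-> _ -> _] := sym_pair c_sym cp; rewrite eqxx.
rewrite -(card_imset _ (@rev_ord_inj (n + n))) (can_imset_pre _ (@rev_ordK (n + n))).
apply/eqP/eq_card => p; rewrite !inE; apply/eqP/eqP => /(sym_sign c_sym) //.
by rewrite rev_ordK.
Qed.

Lemma symclanE c :
  symclan c = [&& is_clan c, c == rev_clan (bar_clan c)
                & [forall p, c p != inr (rev_ord p)]].
Proof.
apply/idP/and3P => [c_sym|[/andP[/forallP c_pair _] /eqP c_rev /forallP c_neq]].
  split; first exact: symclan_is_clan.
    apply/eqP/ffunP => p; rewrite !ffunE -{1}(rev_ordK p).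
    case cp: (c (rev_ord p)) => [b|q]; first by rewrite (sym_sign c_sym cp).
    by have [_ _ _ ->] := sym_pair c_sym cp.
  apply/forallP => p; apply/eqP => /(sym_pair c_sym)[_].
  by rewrite eqxx.
apply/forallP => p; have := c_rev; move/ffunP/(_ (rev_ord p)).
rewrite !ffunE rev_ordK; case cp: (c p) => [b|q] -> //.
have := c_pair p; have := c_neq p; rewrite cp => q_rev /andP[-> ->].
by rewrite eqxx (contraNneq _ q_rev) // => ->.
Qed.

(** Local contributions whose sum over the left half is twice the count in (iii): a [-] weighs 2,
    and a pair inside the left half weighs 1 at each end. *)
Definition weight (a : symbol n) : nat :=
  match a with inl b => if b then 0 else 2 | inr q => q < n end.

Definition weight_sum c := \sum_(p : position n | p < n) weight (c p).

Definition parity c := odd (weight_sum c)./2.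

Lemma weight_sumE c : symclan c -> weight_sum c =
  2 * (#|[set i : 'I_n | c (left_half i) == minus]|
       + #|[set ij : 'I_n * 'I_n | (ij.1 < ij.2)
              && (c (left_half ij.1) == inr (left_half ij.2))]|).
Proof.
move=> c_sym; rewrite /weight_sum (big_ord_narrow (leq_addr n n)).
pose matched i j := c (left_half i) == inr (left_half j).
have matchedC i j : matched i j = matched j i.
  by apply/eqP/eqP => /(sym_pair c_sym)[].
rewrite (eq_bigr (fun i => 2 * (c (left_half i) == minus)
                           + \sum_(j < n) matched i j)); last first.
  move=> i _; rewrite (_ : widen_ord _ i = left_half i); last exact: val_inj.
  rewrite /weight /matched; case: (c _) => [[]|q] /=.
  - by rewrite big1.
  - by rewrite big1.
  case: ltnP => q_n.
    rewrite (bigD1 (Ordinal q_n)) //= big1 => [|j j_q].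
      by rewrite addn0; case: eqP => // -[]; congr inr; apply: val_inj.
    case: eqP => // -[q_j]; case/eqP: j_q; apply: val_inj.
    by rewrite /= q_j.
  rewrite big1 // => j _; case: eqP => // -[q_j].
  by move: q_n; rewrite q_j /= leqNgt ltn_ord.
rewrite big_split /= -big_distrr mulnDr; congr (_ + _).
  congr (2 * _); rewrite -sum1_card [RHS]big_mkcond; apply: eq_bigr => i _.
  by rewrite inE; case: eqP.
(* Each pair inside the left half occurs in both orders; swapping coordinates identifies them, and
   the diagonal contributes nothing. *)
rewrite pair_bigA /= (bigID (fun u : 'I_n * 'I_n => u.1 < u.2)) /= mul2n -addnn.
have -> : #|[set ij : 'I_n * 'I_n | (ij.1 < ij.2) && matched ij.1 ij.2]|
          = \sum_(u : 'I_n * 'I_n | u.1 < u.2) matched u.1 u.2.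
  rewrite -sum1_card big_mkcond [RHS]big_mkcond; apply: eq_bigr => u _.
  by rewrite inE; case: (u.1 < u.2) => //=; case: (matched _ _).
congr (_ + _); rewrite (reindex (fun u : 'I_n * 'I_n => (u.2, u.1))) /=; last first.
  by apply: onW_bij; exists (fun u : 'I_n * 'I_n => (u.2, u.1)); case.
rewrite big_mkcond [RHS]big_mkcond; apply: eq_bigr => -[x y] _ /=.
rewrite matchedC -leqNgt leq_eqVlt; case: eqVneq => //= /val_inj <-.
rewrite ltnn /matched; case: eqP => // /(sym_pair c_sym)[].
by rewrite eqxx.
Qed.

Lemma is_DIIIE c : is_DIII c = symclan c && ~~ parity c.
Proof.
rewrite /is_DIII !andbA -[X in X && _]andbA -symclanE.
case: (boolP (symclan c)) => // c_sym; rewrite /parity weight_sumE //.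
by rewrite mul2n doubleK.
Qed.

Lemma permuteK f c : involutive f -> permute f (permute f c) = c.
Proof.
by move=> fK; apply/ffunP => p; rewrite !ffunE fK; case: (c p) => // q; rewrite fK.
Qed.

Lemma partner_permute f c p : involutive f ->
  partner (permute f c) p = f (partner c (f p)).
Proof. by move=> fK; rewrite /partner ffunE; case: (c (f p)); rewrite ?fK. Qed.

Lemma symclan_permute f c : involutive f -> rev_equiv f -> symclan c ->
  symclan (permute f c).
Proof.
move=> fK f_rev c_sym; apply/forallP => p; rewrite !ffunE f_rev.
case cp: (c (f p)) => [b|q]; first by rewrite (sym_sign c_sym cp).
have [n1 n2 e1 ->] := sym_pair c_sym cp; rewrite ffunE fK e1 fK f_rev !eqxx.
by rewrite !andbT !(can2_eq fK fK) n1 f_rev n2.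
Qed.

Lemma weight_sum_permute f c : involutive f -> (forall x, (f x < n) = (x < n)) ->
  weight_sum (permute f c) = weight_sum c.
Proof.
move=> fK f_left; rewrite /weight_sum (reindex f) /=; last by apply: onW_bij; exists f.
by apply: eq_big => p; rewrite ?f_left // => _; rewrite ffunE fK;
  case: (c p) => //= q; rewrite f_left.
Qed.

(* The diagram automorphism of D_n: conjugation by [flip] exchanges the last
   two simple reflections. *)
Definition flip x := if (x.+1 == n) || (x == n :> nat) then rev_ord x else x.

Lemma flipK : involutive flip.
Proof.
move=> x; rewrite {2}/flip; case: ifP => x_mid; rewrite /flip ?x_mid //.
rewrite ifT ?rev_ordK //=; have := ltn_ord x; lia.
Qed.

Lemma flip_rev : rev_equiv flip.
Proof.
move=> x; rewrite /flip /= (_ : _ || _ = ((x.+1 == n) || (x == n :> nat))).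
  by case: ifP.
have := ltn_ord x; lia.
Qed.

Lemma prec_flip x y : prec (flip x) (flip y) = prec x y.
Proof.
rewrite !precE /flip; have := ltn_ord x; have := ltn_ord y.
do 2![case: ifP => /= ?]; lia.
Qed.

(** If the position of value [n - 1] carries a sign, that sign is reversed. If it is matched, its
    pair starts or stops lying inside the left half. Either way the weight sum changes by 2. *)
Lemma parity_flip c : 0 < n -> symclan c -> parity (permute flip c) = ~~ parity c.
Proof.
move=> n_gt0 c_sym; have z_m : n.-1 < n + n by lia.
pose z : position n := Ordinal z_m.
have z_n : z < n by rewrite /=; lia.
have fz : flip z = rev_ord z by rewrite /flip ifT //=; lia.
have f_left x : x < n -> x != z -> flip x = x.
  move=> x_n; rewrite -val_eqE /flip /= => x_z; rewrite ifF //; lia.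
have rz_n : (rev_ord z < n) = false by rewrite /=; lia.
have f_right x : (x < n) = false -> x != rev_ord z -> flip x = x.
  move=> x_n; rewrite -val_eqE /flip /= => x_z; rewrite ifF //; lia.
suff : weight_sum (permute flip c) = weight_sum c + 2 \/
       weight_sum c = weight_sum (permute flip c) + 2.
  by rewrite /parity => -[] ->; rewrite addn2 /= ?negbK.
rewrite /weight_sum (bigD1 z) //= [X in _ = X + _ \/ X = _](bigD1 z) //=.
rewrite ffunE fz; case cz: (c z) => [b|q].
  rewrite (sym_sign c_sym cz) (eq_bigr (fun p => weight (c p))).
    by case: b {cz} => /=; [left|right]; lia.
  move=> p /andP[p_n p_z]; rewrite ffunE f_left //.
  case cp: (c p) => [//|q] /=; congr (nat_of_bool _).
  have [_ _ cq _] := sym_pair c_sym cp; case: (boolP (q < n)) => q_n.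
    by rewrite f_left ?q_n //; apply: contraPneq cq => ->; rewrite cz.
  rewrite f_right ?(negbTE q_n) //; apply: contraPneq cq => ->.
  by rewrite (sym_sign c_sym cz).
have [q_z q_rz cq crz] := sym_pair c_sym cz; rewrite crz.
have rq_n : (rev_ord q < n) = ~~ (q < n) by rewrite /=; have := ltn_ord q; lia.
have rest p : p < n -> p != z -> p != q -> p != rev_ord q ->
    weight (permute flip c p) = weight (c p).
  move=> p_n p_z p_q p_rq; rewrite ffunE f_left //; case cp: (c p) => [//|r] /=.
  have [_ _ cr _] := sym_pair c_sym cp; congr (nat_of_bool _).
  case: (boolP (r < n)) => r_n.
    rewrite f_left ?r_n //; apply: contra_neq p_q => r_z.
    by move: cr; rewrite r_z cz => -[].
  rewrite f_right ?(negbTE r_n) //; apply: contra_neq p_rq => r_z.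
  by move: cr; rewrite r_z crz => -[].
have fq : flip q = q by rewrite /flip ifF //; move: q_z q_rz; rewrite -!val_eqE /=; lia.
rewrite flip_rev fq /= rq_n.
case: (boolP (q < n)) => q_n.
  rewrite (bigD1 q) ?q_n //= [X in _ \/ _ + X = _](bigD1 q) ?q_n //=.
  rewrite ffunE fq cq /= fz rz_n z_n (eq_bigr (fun p => weight (c p))); first by right; lia.
  move=> p /andP[/andP[p_n p_z] p_q]; apply: rest => //.
  by apply: contraTneq p_n => ->; rewrite rq_n q_n.
have [_ _ _ crq] := sym_pair c_sym cq.
have rq_z : rev_ord q != z by rewrite (inv_eq (@rev_ordK _)).
rewrite (bigD1 (rev_ord q)) ?rq_n ?q_n //=.
rewrite [X in _ = _ + X + _ \/ _](bigD1 (rev_ord q)) ?rq_n ?q_n //=.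
rewrite ffunE flip_rev fq crq /= flip_rev fz rev_ordK rz_n z_n.
rewrite [X in 1 + (1 + X)](eq_bigr (fun p => weight (c p))); first by left; lia.
move=> p /andP[/andP[p_n p_z] p_q]; apply: rest => //.
by apply: contraNneq q_n => <-.
Qed.

End SymmetricClans.

(** * Conjugation and matching by a simple reflection *)

Section RootMoves.
Variable n : nat.
Implicit Types (c : string n) (x y z p q : position n) (i : 'I_n).
Implicit Types (f : position n -> position n) (b : bool).
Hypothesis n_gt1 : 1 < n.

Lemma swap_conj f p q x : involutive f -> rev_equiv f ->
  f (swap p q (f x)) = swap (f p) (f q) x.
Proof.
move=> fK f_rev; rewrite /swap !(can2_eq fK fK) !f_rev.
by do !case: ifP => // _; rewrite ?f_rev ?fK.
Qed.

Lemma simple_left i x : i.+1 < n -> (simple i x < n) = (x < n).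
Proof.
move=> lt_in; rewrite simple_val //=.
have [[_ -> ->]|[e _ _]] := root_val n_gt1 i; last by rewrite e ltnn in lt_in.
by do ![case: eqP => ?]; lia.
Qed.

(** [flip] fixes [n - 2] and exchanges [n - 1] with [n], so it carries the last ordinary root to the
    branching one. This reduces parity questions to reflections preserving the left half. *)
Lemma simple_last i : i.+1 = n ->
  exists2 j : 'I_n, j.+1 < n & forall x, simple i x = flip (simple j (flip x)).
Proof.
move=> i_n; have j_n : n - 2 < n by lia.
have j_last : (Ordinal j_n).+1 < n by rewrite /=; lia.
exists (Ordinal j_n) => // x; rewrite !simpleE //.
rewrite swap_conj; [|exact: flipK|exact: flip_rev].
have [[lt_in]|[_ e1 e2]] := root_val n_gt1 i; first by rewrite i_n ltnn in lt_in.
have [[_ f1 f2]|[ej]] := root_val n_gt1 (Ordinal j_n); last by rewrite ej ltnn in j_last.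
congr swap; apply: val_inj; rewrite /flip /=.
  by case: ifP => /=; rewrite e1 f1 /=; lia.
by case: ifP => /=; rewrite e2 f2 /=; lia.
Qed.

Lemma symclan_simple i c : symclan c -> symclan (permute (simple i) c).
Proof. by apply: symclan_permute; [apply: simpleK|move=> x; apply: simple_rev]. Qed.

(** Ordinary reflections preserve the left half and so the weight sum; for the branching one, the
    conjugation by [flip] reverses the parity twice. *)
Lemma parity_simple i c : symclan c -> parity (permute (simple i) c) = parity c.
Proof.
move=> c_sym; case: (ltnP i.+1 n) => [lt_in|le_ni].
  rewrite /parity weight_sum_permute //; first exact: simpleK.
  by move=> x; apply: simple_left.
have i_n : i.+1 = n by apply/eqP; rewrite eqn_leq le_ni ltn_ord.
have [j lt_jn simple_i] := simple_last i_n.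
have -> : permute (simple i) c
    = permute (@flip n) (permute (simple j) (permute (@flip n) c)).
  apply/ffunP => p; rewrite !ffunE simple_i.
  by case: (c _) => // q; rewrite simple_i.
have n_gt0 : 0 < n by lia.
have cf_sym := symclan_permute (@flipK n) (@flip_rev n) c_sym.
rewrite parity_flip ?symclan_simple // [parity (permute (simple j) _)]/parity.
rewrite weight_sum_permute; [|exact: simpleK|by move=> x; apply: simple_left].
by rewrite -/(parity _) parity_flip // negbK.
Qed.

Definition in_root i x :=
  x \in [:: src i; tgt i; rev_ord (tgt i); rev_ord (src i)].

Definition root_match i c := match_pair (src i) (tgt i)
  (match_pair (rev_ord (tgt i)) (rev_ord (src i)) c).

Lemma root_matchE i c x :
  root_match i c x = if in_root i x then inr (simple i x) else c x.
Proof.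
rewrite !ffunE /in_root !inE simpleE // /swap; have := root_uniq n_gt1 i.
by rewrite /= !inE !negb_or; do ![case: (x =P _) => //= ?]; move=> *; congruence.
Qed.

Lemma in_root_simple i x : in_root i (simple i x) = in_root i x.
Proof.
rewrite /in_root !inE !(can2_eq (simpleK n_gt1 i) (simpleK n_gt1 i)).
rewrite !simple_rev // simple_src // simple_tgt //.
by move: (x == src i) (x == tgt i) (x == rev_ord (src i)) (x == rev_ord (tgt i))
  => [] [] [] [].
Qed.

Lemma in_root_rev i x : in_root i (rev_ord x) = in_root i x.
Proof.
rewrite /in_root !inE !(inv_eq (@rev_ordK _)) !rev_ordK.
by move: (x == src i) (x == tgt i) (x == rev_ord (src i)) (x == rev_ord (tgt i))
  => [] [] [] [].
Qed.

Lemma simple_id i x : ~~ in_root i x -> simple i x = x.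
Proof.
rewrite /in_root !inE !negb_or simpleE // /swap.
by case/and4P=> /negbTE-> /negbTE-> /negbTE-> /negbTE->.
Qed.

Lemma simple_neq i x : in_root i x -> simple i x != x.
Proof.
have := root_uniq n_gt1 i; rewrite /in_root simpleE // /swap /= !inE !negb_or.
by do ![case: (x =P _) => [?|?] //=]; subst; rewrite ?eqxx;
  do ![case: eqP => //= ?]; congruence.
Qed.

Lemma simple_neq_rev i x : in_root i x -> simple i x != rev_ord x.
Proof.
have := root_uniq n_gt1 i; rewrite /in_root simpleE // /swap /= !inE !negb_or.
by do ![case: (x =P _) => [?|?] //=]; subst; rewrite ?eqxx ?rev_ordK;
  do ![case: eqP => //= ?]; congruence.
Qed.

Section Match.
Variables (i : 'I_n) (c : string n) (b : bool).
Hypotheses (c_sym : symclan c) (c_src : c (src i) = inl b)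
           (c_tgt : c (tgt i) = inl (~~ b)).

Lemma root_signs x : in_root i x -> exists b', c x = inl b'.
Proof.
by rewrite /in_root !inE => /or4P[] /eqP->;
  rewrite ?(sym_sign c_sym c_src) ?(sym_sign c_sym c_tgt) ?c_src ?c_tgt; eexists.
Qed.

Lemma root_nsign x y : c x = inr y -> ~~ in_root i x && ~~ in_root i y.
Proof.
move=> cx; have [_ _ cy _] := sym_pair c_sym cx.
by apply/andP; split; apply/negP => /root_signs[b']; rewrite ?cx ?cy.
Qed.

Lemma symclan_match : symclan (root_match i c).
Proof.
apply/forallP => p; rewrite !root_matchE in_root_rev.
case: ifP => p_i.
  rewrite root_matchE in_root_simple p_i simpleK // simple_rev // !eqxx !andbT.
  by rewrite simple_neq // simple_neq_rev.
case cp: (c p) => [b'|q]; first by rewrite (sym_sign c_sym cp).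
have [-> -> cq ->] := sym_pair c_sym cp.
by rewrite root_matchE; have /andP[_ /negbTE->] := root_nsign cp; rewrite cq !eqxx.
Qed.

(** The four positions of the root carry signs, so the old involution fixes them. *)
Lemma partner_match x : partner (root_match i c) x = simple i (partner c x).
Proof.
rewrite /partner root_matchE; case: ifP => x_i.
  by have [b' ->] := root_signs x_i.
case cx: (c x) => [b'|y]; first by rewrite simple_id // x_i.
by rewrite simple_id //; case/andP: (root_nsign cx).
Qed.

(** For an ordinary root, left weights 0 and 2 become 1 and 1. For the branching root, the two left
    positions carry equal signs and become matched to the right half, so the weight sum drops by 0
    or 4. *)
Lemma parity_match : parity (root_match i c) = parity c.
Proof.
have rest x : ~~ in_root i x -> weight (root_match i c x) = weight (c x).
  by rewrite root_matchE => /negbTE->.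
have := root_uniq n_gt1 i; rewrite /= !inE !negb_or.
case/and4P=> /and3P[pq pq' pp'] /andP[qq' qp'] q'p' _.
have cp' := sym_sign c_sym c_src; have cq' := sym_sign c_sym c_tgt.
have mE x : in_root i x -> root_match i c x = inr (simple i x).
  by rewrite root_matchE => ->.
have mp : root_match i c (src i) = inr (tgt i).
  by rewrite mE ?simple_src // /in_root !inE eqxx.
have mq : root_match i c (tgt i) = inr (src i).
  by rewrite mE ?simple_tgt // /in_root !inE eqxx orbT.
have mq' : root_match i c (rev_ord (tgt i)) = inr (rev_ord (src i)).
  by rewrite mE ?simple_rev ?simple_tgt // /in_root !inE eqxx !orbT.
have [[lt_in p_val q_val]|[i_n p_val q_val]] := root_val n_gt1 i.
  have p_n : src i < n by lia.
  have q_n : tgt i < n by lia.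
  rewrite /parity /weight_sum (bigD1 (src i)) //= (bigD1 (tgt i)) /= ?q_n 1?eq_sym //.
  rewrite [in RHS](bigD1 (src i)) //= [in RHS](bigD1 (tgt i)) /= ?q_n 1?eq_sym //.
  rewrite mp mq c_src c_tgt /= p_n q_n.
  rewrite (eq_bigr (fun x => weight (c x))); first by case: b => /=; rewrite ?addnA.
  move=> x /andP[/andP[x_n x_p] x_q]; apply: rest; rewrite /in_root !inE !negb_or x_p x_q /=.
  rewrite -!val_eqE /= p_val q_val; lia.
have p_n : src i < n by lia.
have q_n : rev_ord (tgt i) < n by rewrite /=; lia.
rewrite /parity /weight_sum (bigD1 (src i)) //= (bigD1 (rev_ord (tgt i))) /= ?q_n 1?eq_sym //.
rewrite [in RHS](bigD1 (src i)) //= [in RHS](bigD1 (rev_ord (tgt i))) /= ?q_n 1?eq_sym //.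
have tgt_n : (tgt i < n) = false by lia.
have rsrc_n : (rev_ord (src i) < n) = false by rewrite /=; lia.
rewrite mp mq' c_src cq' negbK [weight (inr _)]/weight [weight (inr _)]/weight tgt_n rsrc_n.
rewrite (eq_bigr (fun x => weight (c x))); first by case: b => /=; rewrite ?addnA //= negbK.
move=> x /andP[/andP[x_n x_p] x_q]; apply: rest; rewrite /in_root !inE !negb_or x_p x_q /=.
rewrite -!val_eqE /= p_val q_val; lia.
Qed.

End Match.

End RootMoves.

(** * The rank statistic and the weak order *)

Section Rank.
Variable n : nat.
Implicit Types (c : string n) (x y z p q : position n) (i : 'I_n).

(** The [2a] pairs of the rank formula have [4a] endpoints, and [dinv] is twice the Coxeter length
    [l], so [2 * dinv + moved] is [4 * (l + a)]. *)
Definition moved c := #|[pred x | partner c x != x]|.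

(* Eight times the rank. *)
Definition stat c := 2 * dinv (partner c) + moved c.

Lemma moved_leq c : moved c <= n + n.
Proof. by rewrite -[leqRHS]card_ord max_card. Qed.

Lemma partner_matchless c x : matchless c -> partner c x = x.
Proof. by move/forallP/(_ x); rewrite /partner; case: (c x). Qed.

Lemma stat_matchless c : matchless c -> stat c = 0.
Proof.
move=> c0; rewrite /stat (@eq_dinv _ _ (1%g : 'S_(n + n))); last first.
  by move=> x; rewrite perm1 partner_matchless.
rewrite dinv_perm0 /moved (eq_card (B := pred0)) ?card0 // => x.
by rewrite !inE partner_matchless ?eqxx.
Qed.

Lemma moved_permute f c : involutive f -> moved (permute f c) = moved c.
Proof.
move=> fK; rewrite /moved -!sum1_card (reindex_inj (inv_inj fK)) /=.
by apply: eq_bigl => x; rewrite !inE partner_permute // fK (inj_eq (inv_inj fK)).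
Qed.

Lemma stat_conj f c : involutive f -> (forall x y, prec (f x) (f y) = prec x y) ->
  stat (permute f c) = stat c.
Proof.
move=> fK f_prec; rewrite /stat; congr (2 * _ + _); last exact: moved_permute.
rewrite /dinv (reindex (fun u => (f u.1, f u.2))) /=; last first.
  by apply: onW_bij; exists (fun u => (f u.1, f u.2)) => -[x y] /=; rewrite !fK.
by apply: eq_bigr => u _; rewrite !partner_permute // !fK !f_prec.
Qed.

Hypothesis n_gt1 : 1 < n.

Definition ascent i c := prec (partner c (src i)) (partner c (tgt i)).

Definition commuting i c :=
  [forall x, simple i (partner c (simple i x)) == partner c x].

Section Symmetric.
Variables (i : 'I_n) (c : string n).
Hypothesis c_sym : symclan c.
Local Notation s := (simple i).
Local Notation sigma := (partner c).

Let sK : involutive s := simpleK n_gt1 i.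
Let sigmaK : involutive sigma := partnerK c_sym.
Let sigma_rev : rev_equiv sigma := partner_rev c_sym.

(** The four positions of the root are then stable under the involution, compatibly with [simple i],
    which is the identity elsewhere. *)
Lemma commuting_root : (sigma (src i), sigma (tgt i)) \in root_pairs i ->
  commuting i c.
Proof.
move=> roots.
have [P_root s_P] : in_root i (sigma (src i)) /\ s (sigma (src i)) = sigma (tgt i).
  move: roots; rewrite /in_root !inE !xpair_eqE.
  by case/or4P=> /andP[/eqP-> /eqP->]; rewrite ?simple_rev // ?simple_src // ?simple_tgt //
     !eqxx ?orbT.
have Q_root : in_root i (sigma (tgt i)) by rewrite -s_P in_root_simple.
have root_stable x : in_root i x -> in_root i (sigma x).
  by rewrite {1}/in_root !inE => /or4P[] /eqP->; rewrite ?sigma_rev ?in_root_rev.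
have s_Q : s (sigma (tgt i)) = sigma (src i) by rewrite -s_P sK.
apply/forallP => x; apply/eqP; case: (boolP (in_root i x)) => x_i.
  by move: x_i; rewrite /in_root !inE => /or4P[] /eqP->;
    rewrite ?simple_rev ?simple_src ?simple_tgt ?sigma_rev ?simple_rev ?s_P ?s_Q.
rewrite (simple_id n_gt1 x_i) simple_id //.
by apply: contra x_i => /root_stable; rewrite sigmaK.
Qed.

Lemma ascent_simple : ascent i c -> ~~ commuting i c ->
  prec (s (sigma (src i))) (s (sigma (tgt i))).
Proof.
by move=> asc ncomm; rewrite prec_simple //; apply: contra ncomm; apply: commuting_root.
Qed.

(** Passing to inverses turns the multiplication into one on the other side, where [dinv_simple]
    applies. *)
Lemma dinv_ascent : ascent i c -> dinv (s \o sigma) = dinv sigma + 2.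
Proof.
move=> asc; rewrite (@dinv_can _ (s \o sigma) (sigma \o s)); last first.
- by move=> x /=; rewrite sigmaK sK.
- by move=> x /=; rewrite sK sigmaK.
have := dinv_simple n_gt1 i (inv_inj sigmaK) sigma_rev.
by rewrite (prec_asym asc) [prec _ _]asc addn0.
Qed.

(** By [ascent_simple] the image of the root stays positive after [simple i], so each of the two
    multiplications adds 2 to [dinv]. *)
Lemma stat_simple : ascent i c -> ~~ commuting i c ->
  stat (permute s c) = stat c + 8.
Proof.
move=> asc ncomm; have asc' := ascent_simple asc ncomm.
have dinv_conj : dinv (partner (permute s c)) = dinv sigma + 4.
  rewrite (@eq_dinv _ _ ((s \o sigma) \o s)) => [|x]; last exact: partner_permute.
  have := @dinv_simple _ n_gt1 i (s \o sigma); rewrite /= asc' (prec_asym asc').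
  rewrite dinv_ascent // addn0 -addnA => -> //.
    exact: inj_comp (inv_inj sK) (inv_inj sigmaK).
  by move=> x /=; rewrite sigma_rev simple_rev.
by rewrite /stat dinv_conj moved_permute //; lia.
Qed.

(** A single multiplication adds 2 to [dinv], and four fixed positions become moved. *)
Lemma stat_match b : c (src i) = inl b -> c (tgt i) = inl (~~ b) ->
  stat (root_match i c) = stat c + 8.
Proof.
move=> c_src c_tgt.
have asc : ascent i c by rewrite /ascent /partner c_src c_tgt prec_root.
rewrite /stat (@eq_dinv _ _ (s \o sigma)) => [|x]; last first.
  exact: partner_match c_sym c_src c_tgt x.
rewrite dinv_ascent //.
suff -> : moved (root_match i c) = moved c + 4 by lia.
have <- : #|in_root i| = 4 by apply/(card_uniqP (root_uniq n_gt1 i)).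
have rootE x : in_root i x = [|| x == src i, x == tgt i, x == rev_ord (tgt i)
                                 | x == rev_ord (src i)] by rewrite /in_root !inE.
rewrite addnC /moved -(cardID (in_root i)); congr (_ + _); apply: eq_card => x;
  rewrite !inE -!rootE (partner_match n_gt1 c_sym c_src c_tgt);
  case: (boolP (in_root i x)) => x_i; rewrite /= ?andbF ?andbT //.
- have [b' cx] := root_signs c_sym c_src c_tgt x_i.
  by rewrite /partner cx simple_neq.
- have [b' cx] := root_signs c_sym c_src c_tgt x_i.
  by rewrite /partner cx eqxx.
rewrite simple_id //; rewrite /partner; case cx: (c x) => [//|y].
by have /andP[] := root_nsign c_sym c_src c_tgt cx.
Qed.

Definition opposite_signs := match c (src i), c (tgt i) with
  | inl b, inl b' => b' == ~~ b | _, _ => false end.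

Lemma opposite_signsP :
  reflect (exists2 b, c (src i) = inl b & c (tgt i) = inl (~~ b)) opposite_signs.
Proof.
rewrite /opposite_signs; apply: (iffP idP) => [|[b -> ->]]; last exact: eqxx.
by case: (c _) => // b; case: (c _) => // b' /eqP->; exists b.
Qed.

End Symmetric.

(** The choice of [+] at [src i] is arbitrary: the opposite choice is matched to the same clan. *)
Definition unmatch i c : string n := [ffun x =>
  if in_root i x then inl ((x == src i) || (x == rev_ord (tgt i))) else c x].

Section Unmatch.
Variables (i : 'I_n) (c : string n).
Hypotheses (c_sym : symclan c) (c_src : c (src i) = inr (tgt i)).

Lemma root_matched x : in_root i x -> c x = inr (simple i x).
Proof.
have [_ _ c_tgt c_rsrc] := sym_pair c_sym c_src.
have [_ _ _ c_rtgt] := sym_pair c_sym c_tgt.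
by rewrite /in_root !inE => /or4P[] /eqP->; rewrite ?simple_rev ?simple_src ?simple_tgt.
Qed.

Lemma symclan_unmatch : symclan (unmatch i c).
Proof.
apply/forallP => x; rewrite !ffunE in_root_rev //; case: ifP => x_i.
  apply/eqP; congr inl; rewrite !(inv_eq (@rev_ordK _)) rev_ordK.
  have := root_uniq n_gt1 i; move: x_i; rewrite /in_root /= !inE !negb_or.
  by do ![case: (x =P _) => //= ?]; subst; do ![case: eqP => //= ?]; move=> *; congruence.
case cx: (c x) => [b|y]; first by rewrite (sym_sign c_sym cx).
have [-> -> cy ->] := sym_pair c_sym cx; rewrite ffunE ifF ?cy ?eqxx //.
apply: contraFF x_i => y_i; move: cy; rewrite root_matched // => -[<-].
by rewrite in_root_simple.
Qed.

Lemma unmatchK : root_match i (unmatch i c) = c.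
Proof.
apply/ffunP => x; rewrite root_matchE // ffunE; case: ifP => x_i.
  by rewrite root_matched.
by rewrite x_i.
Qed.

Lemma unmatch_signs : unmatch i c (src i) = inl true /\ unmatch i c (tgt i) = inl false.
Proof.
have := root_uniq n_gt1 i; rewrite /= !ffunE /in_root !inE !eqxx orbT /= !negb_or.
by case/and4P=> /andP[n1 _] /andP[n2 _] _ _; rewrite eq_sym (negbTE n1) (negbTE n2).
Qed.

End Unmatch.

Lemma commuting_signs i c b b' : symclan c -> c (src i) = inl b -> c (tgt i) = inl b' ->
  ascent i c && commuting i c.
Proof.
move=> c_sym c_src c_tgt; rewrite /ascent commuting_root //.
  by rewrite /partner c_src c_tgt prec_root.
by rewrite /partner c_src c_tgt !inE eqxx.
Qed.

Inductive weak_step i c : string n -> Prop :=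
  | StepConj of ascent i c & ~~ commuting i c : weak_step i c (permute (simple i) c)
  | StepMatch of opposite_signs i c : weak_step i c (root_match i c).

Lemma weak_step_sym i c c' : symclan c -> weak_step i c c' -> symclan c'.
Proof.
move=> c_sym [_ _|/opposite_signsP[b c_src c_tgt]]; first exact: symclan_simple.
exact: symclan_match c_src c_tgt.
Qed.

Lemma weak_step_parity i c c' : symclan c -> weak_step i c c' -> parity c' = parity c.
Proof.
move=> c_sym [_ _|/opposite_signsP[b c_src c_tgt]]; first exact: parity_simple.
exact: parity_match c_src c_tgt.
Qed.

Lemma weak_step_stat i c c' : symclan c -> weak_step i c c' -> stat c' = stat c + 8.
Proof.
move=> c_sym [asc ncomm|/opposite_signsP[b c_src c_tgt]]; first exact: stat_simple.
exact: stat_match c_src c_tgt.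
Qed.

Lemma descent i c : symclan c -> ~~ ascent i c ->
  prec (partner c (tgt i)) (partner c (src i)).
Proof.
move=> c_sym nasc; have root_i := prec_root n_gt1 i.
apply: prec_total; rewrite // -?(partner_rev c_sym) (inj_eq (inv_inj (partnerK c_sym))).
  by apply: contraTneq root_i => ->; rewrite precE ltnn.
by apply: contraTneq root_i => ->; rewrite /prec eqxx andbF.
Qed.

(** Otherwise [no_descent] makes the involution preserve [prec], yet it exchanges the two comparable
    ends of a matching pair. *)
Lemma exists_descent c : symclan c -> ~~ matchless c -> exists i, ~~ ascent i c.
Proof.
move=> c_sym; rewrite negb_forall => /existsP[x].
case cx: (c x) => [//|y] _; apply/existsP; rewrite -negb_forall.
apply/negP => /forallP asc.
have no_inv := no_descent n_gt1 (partner_rev c_sym) (inv_inj (partnerK c_sym)) asc.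
have [y_x y_rx cy _] := sym_pair c_sym cx.
have px : partner c x = y by rewrite /partner cx.
have py : partner c y = x by rewrite /partner cy.
have [xy|xy] := boolP (prec x y).
  by have := no_inv _ _ xy; rewrite px py (prec_asym xy).
by have yx := prec_total y_x y_rx xy; have := no_inv _ _ yx; rewrite px py (negbTE xy).
Qed.

(** At a descent a last action can be undone: by conjugation if the reflection does not commute with
    the involution, by unmatching if it does. *)
Lemma weak_predecessor c : symclan c -> ~~ matchless c ->
  exists i, exists2 c0, symclan c0 & weak_step i c0 c.
Proof.
move=> c_sym /(exists_descent c_sym)[i nasc]; exists i.
have sK := simpleK n_gt1 i; have sigmaK := partnerK c_sym.
have root_i := prec_root n_gt1 i; have desc := descent c_sym nasc.
have [comm|ncomm] := boolP (commuting i c); last first.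
  exists (permute (simple i) c); first exact: symclan_simple.
  rewrite -{2}[c](permuteK c sK); apply: StepConj.
    rewrite /ascent !partner_permute // simple_src // simple_tgt // prec_simple //.
    apply: contra ncomm => roots; apply: commuting_root => //; move: roots.
    by rewrite !inE !xpair_eqE => /or4P[] /andP[-> ->]; rewrite ?orbT.
  apply: contra ncomm => /forallP comm; apply/forallP => x.
  by have := comm x; rewrite !partner_permute // !sK eq_sym.
have s_src : simple i (partner c (src i)) = partner c (tgt i).
  by have /forallP/(_ (tgt i))/eqP := comm; rewrite simple_tgt.
have s_tgt : simple i (partner c (tgt i)) = partner c (src i) by rewrite -s_src sK.
have c_src : c (src i) = inr (tgt i).
  (* [simple i] reverses this pair, which is impossible outside [root_pairs]. Of the four cases, two
     contradict the descent and one matches a position to its mirror. *)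
  have : (partner c (tgt i), partner c (src i)) \in root_pairs i.
    apply: contraT => /(prec_simple n_gt1); rewrite s_src s_tgt desc.
    by rewrite (prec_asym desc).
  rewrite !inE !xpair_eqE => /or4P[] /andP[/eqP e1 /eqP e2].
  - move: e2; rewrite /partner; case: (c _) => [b e|q ->] //.
    by move: root_i; rewrite -e precE ltnn.
  - by move: desc; rewrite e1 e2 (prec_asym root_i).
  - by have := partner_neq_rev (tgt i) c_sym; rewrite e1 eqxx.
  - by move: desc; rewrite e1 e2 prec_rev (prec_asym root_i).
exists (unmatch i c); first exact: symclan_unmatch.
rewrite -{2}(unmatchK c_sym c_src); apply: StepMatch.
by apply/opposite_signsP; exists true; have [] := unmatch_signs i c.
Qed.

(** Induction along the weak order, well founded because each step down lowers [stat] by 8. *)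
Lemma stat_ind (P : string n -> Prop) :
  (forall c, symclan c -> matchless c -> P c) ->
  (forall i c c', symclan c -> weak_step i c c' -> P c -> P c') ->
  forall c, symclan c -> P c.
Proof.
move=> Pmatchless Pstep c; have [k] := ubnP (stat c); elim: k c => // k IHk c le_k c_sym.
have [c0|c0] := boolP (matchless c); first exact: Pmatchless.
have [i [c1 c1_sym step]] := weak_predecessor c_sym c0.
by apply: (Pstep i c1) => //; apply: IHk => //; have := weak_step_stat c1_sym step; lia.
Qed.

(** The identity is even and each step multiplies by even reflections. This places the involution in
    type D, as [coxeter_lengthE] requires. *)
Lemma odd_underlying c : symclan c -> odd_perm (underlying c) = false.
Proof.
have uE c1 x : symclan c1 -> underlying c1 x = partner c1 x.
  by move=> c1_sym; rewrite underlyingE //; apply: symclan_is_clan.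
move: c; apply: stat_ind => [c c_sym c0|i c c' c_sym step].
  rewrite (_ : underlying c = 1%g) ?odd_perm1 //.
  by apply/permP => x; rewrite uE // perm1 partner_matchless.
have c'_sym := weak_step_sym c_sym step.
case: step c'_sym => [_ _|/opposite_signsP[b c_src c_tgt]] c'_sym <-.
  rewrite (_ : underlying _ = (simple i * underlying c * simple i)%g).
    by rewrite !odd_permM odd_simple //= addbF.
  by apply/permP => x; rewrite !permM !uE // partner_permute //; apply: simpleK.
rewrite (_ : underlying _ = (underlying c * simple i)%g).
  by rewrite odd_permM odd_simple //= addbF.
by apply/permP => x; rewrite permM !uE // (partner_match n_gt1 c_sym c_src c_tgt).
Qed.

End Rank.

(** * The weak order and its length function *)

Section WeakOrder.
Variable n : nat.
Implicit Types (c : string n) (x y z p q : position n) (i : 'I_n).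

Lemma symclan_underlying c x : symclan c -> underlying c x = partner c x.
Proof. by move=> c_sym; rewrite underlyingE //; apply: symclan_is_clan. Qed.

Section Simple.
Hypothesis n_gt1 : 1 < n.

Lemma coxeter_ascent i c : symclan c ->
  (coxeter_length (underlying c) < coxeter_length (simple i * underlying c)%g)
    = ascent i c.
Proof.
move=> c_sym; have uE x := symclan_underlying x c_sym.
have u_rev : rev_equiv (underlying c) by move=> x; rewrite !uE partner_rev.
have := @dinv_simple _ n_gt1 i _ (@perm_inj _ (underlying c)) u_rev.
(* This product applies [simple i] first, as [dinv_simple] expects. *)
rewrite (@eq_dinv _ _ (simple i * underlying c)%g) => [|x]; last by rewrite permM.
rewrite !coxeter_lengthE ?odd_permM ?odd_simple ?odd_underlying //; last first.
  by move=> x; rewrite !permM simple_rev // u_rev.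
rewrite !uE; have [asc|desc] := boolP (ascent i c).
  by rewrite [prec (partner c (src i)) _]asc (prec_asym asc) => ?; apply/idP; lia.
have := descent n_gt1 c_sym desc => d; rewrite d (prec_asym d) => ?; apply/idP; lia.
Qed.

Lemma commutingE i c : symclan c ->
  ((simple i * underlying c * simple i)%g == underlying c) = commuting i c.
Proof.
move=> c_sym; apply/eqP/forallP => [u_comm x|comm].
  rewrite -!symclan_underlying // -{2}u_comm !permM eqxx //.
apply/permP => x; rewrite !permM !symclan_underlying //; exact/eqP.
Qed.

(** In the branching case symmetry recovers the block of four signs from those at [src i] and
    [tgt i], so cases (2) and (3) become one rule. *)
Lemma actE i c : symclan c -> Defs.act i c =
  if ascent i c then
    if ~~ commuting i c then permute (simple i) c
    else if opposite_signs i c then root_match i c else c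
  else c.
Proof.
move=> c_sym; rewrite /Defs.act coxeter_ascent // commutingE //.
case: (ascent i c) => //; case: (commuting i c) => //=.
rewrite /opposite_signs /root_match /src /tgt; case: (i.+1 < n).
  by case: (c (left_half i)) => [[]|?]; case: (c (left_half (ordS i))) => [[]|?].
rewrite rev_ordK; have rev_signs x b := @sym_sign _ c x b c_sym.
case cp: (c (left_half (ord_pred i))) => [b|?]; last by case: (c _).
rewrite (rev_signs _ _ cp).
case cq: (c (rev_ord (left_half i))) => [b'|y].
  have := rev_signs _ _ cq; rewrite rev_ordK => ->.
  by case: b {cp}; case: b' {cq}.
by case: b {cp}; case: (c (left_half i)) => [[]|?].
Qed.

Lemma act_step i c c' : symclan c -> weak_step i c c' -> Defs.act i c = c'.
Proof.
move=> c_sym; rewrite actE // => -[-> -> //|opp].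
have /opposite_signsP[b c_src c_tgt] := opp.
by have /andP[-> ->] := commuting_signs n_gt1 c_sym c_src c_tgt; rewrite opp.
Qed.

Lemma step_act i c : symclan c -> Defs.act i c != c -> weak_step i c (Defs.act i c).
Proof.
move=> c_sym; rewrite actE //; case: ifP => [asc|_]; last by rewrite eqxx.
case: ifP => ncomm; first by move=> _; apply: StepConj.
by case: ifP => [opp _|_]; [apply: StepMatch|rewrite eqxx].
Qed.

(** Every changing action adds 8 to [stat]; hence the length of a clan is unique and the weak order
    is graded. *)
Lemma has_length_stat k c : has_length k c -> c \in Delta n /\ stat c = 8 * k.
Proof.
elim: k c => [|k IHk] c /=.
  by case/andP=> c_Delta c0; rewrite stat_matchless.
case/existsP=> c0 /andP[/IHk[c0_Delta c0_stat] /existsP[i /andP[/eqP <- nc]]].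
move: c0_Delta; rewrite !inE !is_DIIIE => /andP[c0_sym c0_par].
have step := step_act c0_sym nc.
rewrite (weak_step_sym n_gt1 c0_sym step) (weak_step_parity n_gt1 c0_sym step).
by rewrite (weak_step_stat n_gt1 c0_sym step); split=> //; lia.
Qed.

Lemma exists_length c : c \in Delta n -> exists k, has_length k c.
Proof.
rewrite inE is_DIIIE => /andP[]; elim/(stat_ind n_gt1): c / => [c c_sym c0 c_par|].
  by exists 0; rewrite /= inE is_DIIIE c_sym c_par.
move=> i c c' c_sym step IHc; rewrite (weak_step_parity n_gt1 c_sym step) => c_par.
have [k len_k] := IHc c_par; exists k.+1; apply/existsP; exists c.
rewrite [X in X && _]len_k /=.
apply/existsP; exists i; rewrite (act_step c_sym step) eqxx /=.
by apply: contra_eqN (weak_step_stat n_gt1 c_sym step) => /eqP->; lia.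
Qed.

End Simple.

(** Keeps the search defining [L] below its cut-off: [stat] is at most quadratic, while the number
    of strings, [(2 + 2n)^(2n)], is at least the square of its base. *)
Lemma stat_bound c : 0 < n -> stat c < 8 * #|{: string n}|.
Proof.
move=> n_gt0; have := dinv_leq (partner c); have := moved_leq c; rewrite /stat.
rewrite card_ffun card_sum card_bool !card_ord.
have : (2 + (n + n)) ^ 2 <= (2 + (n + n)) ^ (n + n) by rewrite leq_pexp2l //; lia.
rewrite -[_ ^ 2]mulnn; nia.
Qed.

Lemma matchless1 c : n <= 1 -> symclan c -> matchless c.
Proof.
move=> n_le1 c_sym; apply/forallP => p; case cp: (c p) => [//|q].
have [] := sym_pair c_sym cp; rewrite -!val_eqE /=.
have := ltn_ord p; have := ltn_ord q; lia.
Qed.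

Lemma stat_L c : 0 < n -> c \in Delta n -> stat c = 8 * L c.
Proof.
move=> n_gt0 c_Delta.
have [n_gt1|n_le1] := ltnP 1 n; last first.
  (* For [n = 1] there are no genuine reflections; every clan is matchless and the search stops at
     0. *)
  have c0 : matchless c by move: c_Delta; rewrite inE is_DIIIE => /andP[/(matchless1 n_le1)].
  rewrite stat_matchless // /L /least; have := stat_bound c n_gt0.
  by case: #|_| => //= b _; rewrite c_Delta c0.
have [k len_k] := exists_length n_gt1 c_Delta.
have [_ stat_c] := has_length_stat n_gt1 len_k.
have k_bound : k < #|{: string n}| by have := stat_bound c n_gt0; rewrite stat_c; lia.
rewrite stat_c /L /least; congr (8 * _); set P := fun j => _.
have hasP : has P (iota 0 #|{: string n}|).
  by apply/hasP; exists k; rewrite ?mem_iota.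
have find_lt : find P (iota 0 #|{: string n}|) < #|{: string n}|.
  by rewrite -[X in _ < X](size_iota 0) -has_find.
have := nth_find 0 hasP; rewrite nth_iota // => /(has_length_stat n_gt1)[_].
by rewrite stat_c; lia.
Qed.

End WeakOrder.

(** * Deleting the outer signs *)

Definition pos0 n : position n.+1 := Ordinal (ltn0Sn (n + n.+1)).

Lemma shift_proof n (p : position n) : p.+1 < n.+1 + n.+1.
Proof. by have := ltn_ord p; lia. Qed.

Definition shift n (p : position n) : position n.+1 := Ordinal (shift_proof p).

Definition shift_symbol n (a : symbol n) : symbol n.+1 :=
  match a with inl b => inl b | inr q => inr (shift q) end.

(** Past the first position, [insub x.-1] fails only at the last one, which gets the opposite
    sign. *)
Definition insert_signs n b (c : string n) : string n.+1 := [ffun x =>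
  if x == pos0 n then inl b
  else if insub x.-1 is Some p then shift_symbol (c p) else inl (~~ b)].

(** The default [p] is not met on symmetric clans with outer signs, where partners of inner
    positions are inner. *)
Definition delete_signs n (c : string n.+1) : string n := [ffun p =>
  match c (shift p) with inl b => inl b | inr q => inr (insubd p q.-1) end].

Section Deletion.
Variable n : nat.
Implicit Types (c : string n) (d : string n.+1) (x y : position n.+1) (p q : position n).
Implicit Types b : bool.

Lemma shift_inj : injective (@shift n).
Proof. by move=> p q [] /val_inj. Qed.

Lemma shift_symbol_inj : injective (@shift_symbol n).
Proof.
case=> [b|p] [b'|q] //= [] => [->|pq] //; congr inr; apply: shift_inj.
by apply: val_inj; rewrite /= pq.
Qed.

Lemma shift_rev p : shift (rev_ord p) = rev_ord (shift p).
Proof. by apply: val_inj => /=; have := ltn_ord p; lia. Qed.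

Lemma shift_neq0 p : (shift p == pos0 n) = false.
Proof. by rewrite -val_eqE. Qed.

Lemma shift_neq_last p : (shift p == rev_ord (pos0 n)) = false.
Proof. by rewrite -val_eqE /=; have := ltn_ord p; lia. Qed.

Lemma shiftK p : insub (shift p).-1 = Some p.
Proof. exact: valK. Qed.

Variant shift_spec x : Prop :=
  | ShiftFirst of x = pos0 n
  | ShiftLast of x = rev_ord (pos0 n)
  | Shift p of x = shift p.

Lemma shiftP x : shift_spec x.
Proof.
have [x0|x0] := eqVneq x (pos0 n); first exact: ShiftFirst.
have [x1|x1] := eqVneq x (rev_ord (pos0 n)); first exact: ShiftLast.
have x_n : x.-1 < n + n.
  by move: x0 x1; rewrite -!val_eqE /=; have := ltn_ord x; lia.
apply: (@Shift _ (Ordinal x_n)); apply: val_inj => /=.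
by move: x0; rewrite -val_eqE /=; lia.
Qed.

Lemma big_shift (F : position n.+1 -> nat) :
  \sum_x F x = F (pos0 n) + F (rev_ord (pos0 n)) + \sum_p F (shift p).
Proof.
rewrite (bigD1 (pos0 n)) //= (bigD1 (rev_ord (pos0 n))) /= ?rev_ord_neq //.
rewrite addnA; congr (_ + _).
rewrite (reindex_omap (@shift n) (fun x => insub x.-1)).
  by apply: eq_bigl => p; rewrite shift_neq0 shift_neq_last shiftK eqxx.
by move=> x /andP[]; case: (shiftP x) => [->|->|p -> _ _]; rewrite ?eqxx // shiftK.
Qed.

Lemma insert_first b c : insert_signs b c (pos0 n) = inl b.
Proof. by rewrite ffunE eqxx. Qed.

Lemma insert_last b c : insert_signs b c (rev_ord (pos0 n)) = inl (~~ b).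
Proof.
rewrite ffunE (negbTE (rev_ord_neq _)) insubF //=; lia.
Qed.

Lemma insert_shift b c p : insert_signs b c (shift p) = shift_symbol (c p).
Proof. by rewrite ffunE shift_neq0 shiftK. Qed.

Definition insertE := (insert_first, insert_last, insert_shift).

Lemma insertK b : cancel (insert_signs b) (@delete_signs n).
Proof.
move=> c; apply/ffunP => p; rewrite ffunE insert_shift.
by case: (c p) => //= q; congr inr; rewrite /insubd shiftK.
Qed.

Lemma deleteK b d : symclan d -> d (pos0 n) = inl b ->
  insert_signs b (delete_signs d) = d.
Proof.
move=> d_sym d0; have d1 := sym_sign d_sym d0.
apply/ffunP => x; case: (shiftP x) => [->|->|p ->]; rewrite insertE ?d0 ?d1 //.
rewrite ffunE; case dp: (d (shift p)) => [//|y] /=; congr inr.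
have [_ _ dy _] := sym_pair d_sym dp; case: (shiftP y) dy => [->|->|q ->].
- by rewrite d0.
- by rewrite d1.
by rewrite /insubd shiftK.
Qed.

Lemma symclan_insert b c : symclan (insert_signs b c) = symclan c.
Proof.
apply/idP/idP => [ic_sym|c_sym]; apply/forallP.
  move=> p; case cp: (c p) => [b'|q].
    have /(sym_sign ic_sym) : insert_signs b c (shift p) = inl b' by rewrite insertE cp.
    rewrite -shift_rev insertE; case: (c _) => //= b'' [->]; exact: eqxx.
  have /(sym_pair ic_sym) : insert_signs b c (shift p) = inr (shift q) by rewrite insertE cp.
  rewrite -!shift_rev !insertE !(inj_eq shift_inj) => -[-> -> cq crp] /=.
  by apply/andP; split; apply/eqP; apply: shift_symbol_inj.
move=> x; case: (shiftP x) => [->|->|p ->]; rewrite ?rev_ordK -?shift_rev !insertE ?negbK ?eqxx //.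
case cp: (c p) => [b'|q] /=; first by rewrite (sym_sign c_sym cp).
have [q_p q_rp cq crp] := sym_pair c_sym cp.
by rewrite insertE -shift_rev !(inj_eq shift_inj) q_p q_rp cq crp /= shift_rev !eqxx.
Qed.

Lemma partner_insert b c :
  [/\ partner (insert_signs b c) (pos0 n) = pos0 n,
      partner (insert_signs b c) (rev_ord (pos0 n)) = rev_ord (pos0 n)
    & forall p, partner (insert_signs b c) (shift p) = shift (partner c p)].
Proof. by split=> [||p]; rewrite /partner insertE //; case: (c p). Qed.

Lemma prec_shift p q : prec (shift p) (shift q) = prec p q.
Proof. by rewrite !precE /=; lia. Qed.

Lemma prec_first x : prec x (pos0 n) = false.
Proof. by rewrite precE /=; lia. Qed.

Lemma prec_last x : prec (rev_ord (pos0 n)) x = false.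
Proof. by rewrite precE /=; have := ltn_ord x; lia. Qed.

(** The outer positions are fixed and extremal for [prec], so they take part in no inversion. *)
Lemma stat_insert b c : stat (insert_signs b c) = stat c.
Proof.
have [f0 f1 fs] := partner_insert b c.
have dinvE m (f : position m -> position m) :
    dinv f = \sum_u \sum_v (prec u v && prec (f v) (f u) : nat).
  by rewrite (pair_bigA _ (fun u v => prec u v && prec (f v) (f u) : nat)).
rewrite /stat /moved; congr (2 * _ + _).
  rewrite !dinvE big_shift big1 => [|y _]; last by rewrite f0 prec_first andbF.
  rewrite big1 => [|y _]; last by rewrite prec_last.
  rewrite !add0n.
  apply: eq_bigr => p _; rewrite big_shift f0 f1 prec_first prec_last andbF !add0n.
  by apply: eq_bigr => q _; rewrite !fs !prec_shift.
rewrite -!sum1_card big_mkcond big_shift !inE f0 f1 !eqxx !add0n [RHS]big_mkcond.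
by apply: eq_bigr => p _; rewrite !inE fs (inj_eq shift_inj).
Qed.

(** An initial [-] adds 2 to the weight sum; the last symbol lies in the right half. *)
Lemma parity_insert b c : parity (insert_signs b c) = ~~ b (+) parity c.
Proof.
have -> : parity (insert_signs b c) = odd ((2 * ~~ b + weight_sum c)./2).
  rewrite /parity /weight_sum big_mkcond big_shift !insertE; congr (odd (_./2)).
  have last_n : (rev_ord (pos0 n) < n.+1) = false by rewrite /=; lia.
  rewrite last_n addn0; congr (_ + _); first by case: b.
  rewrite [RHS]big_mkcond; apply: eq_bigr => p _; rewrite insertE /= ltnS.
  by case: ifP => // _; case: (c p).
by rewrite mul2n halfD odd_double andFb add0n doubleK oddD; case: b.
Qed.

End Deletion.

(** * Generating functions *)

Section GeneratingFunctions.
Import GRing.Theory.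
Local Open Scope ring_scope.

Definition gf n (P : pred (string n)) : {poly int} :=
  \sum_(c : string n | symclan c && P c) 'X^(stat c %/ 8).

Definition class_gf n e := gf (fun c : string n => parity c == e).

Definition head_gf n e a :=
  gf (fun c : string n.+1 => (parity c == e) && (c (pos0 n) == a)).

Arguments head_gf n e a : clear implicits.

Lemma A_class_gf n : (0 < n)%N -> A n = class_gf n false.
Proof.
move=> n_gt0; rewrite /A /class_gf /gf; apply: eq_big => c.
  by rewrite inE is_DIIIE eqbF_neg.
by move=> c_Delta; rewrite stat_L // mulKn.
Qed.

(** Conjugation by [flip] preserves [prec], hence [stat], and reverses the parity. *)
Lemma class_gf_flip n : (0 < n)%N -> class_gf n true = class_gf n false.
Proof.
move=> n_gt0; rewrite /class_gf /gf.
have permK : involutive (permute (@flip n)) by move=> c; apply: permuteK; apply: flipK.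
have flip_sym c : symclan (permute (@flip n) c) = symclan c.
  have flip_sym c' := symclan_permute (c := c') (@flipK n) (@flip_rev n).
  by apply/idP/idP => /flip_sym; rewrite ?permK.
rewrite (reindex_inj (inv_inj permK)) /=; apply: eq_big => c.
  rewrite flip_sym; case: (boolP (symclan c)) => // c_sym.
  by rewrite parity_flip //; case: parity.
by rewrite stat_conj //; [apply: flipK|apply: prec_flip].
Qed.

Lemma gf_delete n b (Q : pred (string n)) :
  gf (fun d => (d (pos0 n) == inl b) && Q (delete_signs d)) = gf Q.
Proof.
rewrite /gf (reindex_onto (insert_signs b) (@delete_signs n)) /=.
  apply: eq_big => c; last by rewrite stat_insert.
  by rewrite symclan_insert insert_first insertK !eqxx andbT.
by move=> d /and3P[d_sym /eqP d0 _]; apply: deleteK.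
Qed.

Lemma head_gf_sign n e b : head_gf n e (inl b) = class_gf n (e (+) ~~ b).
Proof.
rewrite -[RHS](gf_delete b); apply: eq_bigl => d.
case: (boolP (symclan d)) => //= d_sym; rewrite andbC; case: eqP => //= d0.
by rewrite -{1}(deleteK d_sym d0) parity_insert; case: b {d0}; case: parity; case: e.
Qed.

Lemma class_gf_head n e : class_gf n.+1 e = \sum_a head_gf n e a.
Proof.
rewrite /class_gf /gf (partition_big (fun c : string n.+1 => c (pos0 n)) predT) //=.
by apply: eq_bigr => a _; apply: eq_bigl => c; rewrite -andbA.
Qed.

Lemma head_gf_bad n e q :
  (q == pos0 n) || (q == rev_ord (pos0 n)) -> head_gf n e (inr q) = 0.
Proof.
move=> q_bad; rewrite /head_gf /gf big_pred0 // => c.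
apply/negP => /and3P[c_sym _ /eqP /(sym_pair c_sym)[n1 n2 _ _]].
by move: q_bad; rewrite (negbTE n1) (negbTE n2).
Qed.

(** Permuting by [simple i] moves the partner of the first position from [q] to [q']. The involution
    sends [q] to the first position, which gives an ascent; and [simple i] fixes the first position
    but not its partner, so it does not commute with the involution. *)
Lemma head_gf_simple n e (i : 'I_n.+1) (q q' : position n.+1) : (0 < n)%N ->
  simple i (pos0 n) = pos0 n ->
  (q, q') \in [:: (src i, tgt i); (rev_ord (tgt i), rev_ord (src i))] ->
  head_gf n e (inr q') = 'X * head_gf n e (inr q).
Proof.
move=> n_gt0 s_0 qq'; have n_gt1 : (1 < n.+1)%N by [].
have sK := simpleK n_gt1 i.
have permK : involutive (permute (simple i)) by move=> c; apply: permuteK.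
have s_q : simple i q = q'.
  by move: qq'; rewrite !inE !xpair_eqE => /orP[] /andP[/eqP-> /eqP->];
    rewrite ?simple_rev ?simple_src ?simple_tgt.
have q_neq : q != q'.
  rewrite -s_q eq_sym simple_neq //; move: qq'.
  by rewrite !inE !xpair_eqE /in_root !inE => /orP[] /andP[/eqP-> _]; rewrite eqxx ?orbT.
rewrite /head_gf /gf big_distrr /= (reindex_inj (inv_inj permK)) /=.
have s_sym c : symclan (permute (simple i) c) = symclan c.
  by apply/idP/idP => /(symclan_simple n_gt1 i); rewrite ?permK.
apply: eq_big => c.
  rewrite s_sym; case: (boolP (symclan c)) => // c_sym; rewrite parity_simple //=.
  congr (_ && _); rewrite ffunE s_0; case: (c _) => [//|y].
  apply/eqP/eqP => -[]; last by move=> ->; rewrite s_q.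
  by rewrite -s_q => /(inv_inj sK) ->.
case/and3P; rewrite s_sym => c_sym _; rewrite ffunE s_0 => /eqP c0'.
have c0 : c (pos0 n) = inr q.
  by case: (c _) c0' => // y []; rewrite -s_q => /(inv_inj sK) ->.
have [q_0 q_r0 cq _] := sym_pair c_sym c0.
have pq : partner c q = pos0 n by rewrite /partner cq.
have first_lt x y : x != y -> x != rev_ord y -> partner c x = pos0 n ->
    prec (partner c x) (partner c y).
  move=> x_y x_ry px; have := partner_rev c_sym y.
  have y_0 : partner c y != pos0 n.
    by rewrite -px (inj_eq (inv_inj (partnerK c_sym))) eq_sym.
  have y_1 : partner c y != rev_ord (pos0 n).
    rewrite -px -(partner_rev c_sym) (inj_eq (inv_inj (partnerK c_sym))).
    by rewrite -(inv_eq (@rev_ordK _)) eq_sym.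
  by rewrite /prec px y_1 andbT; move: y_0; rewrite -val_eqE /=; lia.
have asc : ascent i c.
  have := root_uniq n_gt1 i; rewrite /= !inE !negb_or.
  case/and4P=> /and3P[n1 n2 n3] /andP[n4 n5] n6 _.
  move: qq'; rewrite !inE !xpair_eqE => /orP[] /andP[/eqP e1 _]; rewrite e1 in pq.
    exact: first_lt.
  (* Here [q] lies on the mirror side of the root, so the ascent is read off the mirror pair. *)
  rewrite /ascent -prec_rev -!(partner_rev c_sym); apply: first_lt => //.
  by rewrite rev_ordK eq_sym.
have ncomm : ~~ commuting i c.
  apply/negP => /forallP/(_ (pos0 n)); rewrite s_0 {1 2}/partner c0 s_q.
  by rewrite eq_sym (negbTE q_neq).
by rewrite stat_simple // (divnDr _ (dvdnn 8)) addn1 exprS.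
Qed.

(** Unmatching the first two symbols into [+-] lowers the rank by one; deleting the [+] keeps the
    parity and deleting the [-] reverses it. *)
Lemma head_gf_match n e : head_gf n.+1 e (inr (shift (pos0 n)))
  = 'X * class_gf n (~~ e).
Proof.
have n_gt1 : (1 < n.+2)%N by [].
pose i : 'I_n.+2 := ord0.
have [[_ src_val tgt_val]|[]//] := root_val n_gt1 i.
have srcE : src i = pos0 n.+1 by apply: val_inj.
have tgtE : tgt i = shift (pos0 n) by apply: val_inj.
transitivity ('X * gf (fun c : string n.+2 => (parity c == e)
    && ((c (src i) == inl true) && (c (tgt i) == inl false)))).
  rewrite /head_gf /gf big_distrr -srcE -tgtE.
  rewrite (reindex_onto (root_match i) (unmatch i)) /=; last first.
    by move=> c /and3P[c_sym _ /eqP]; apply: unmatchK.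
  have good c : symclan c -> c (src i) = inl true -> c (tgt i) = inl false ->
      [/\ symclan (root_match i c), parity (root_match i c) = parity c,
          root_match i c (src i) = inr (tgt i) & unmatch i (root_match i c) = c].
    move=> c_sym c_src c_tgt; split; first exact: symclan_match c_sym c_src c_tgt.
    - exact: parity_match c_sym c_src c_tgt.
    - by rewrite root_matchE // /in_root inE eqxx simple_src.
    apply/ffunP => x; rewrite ffunE; case: ifP => x_i; last by rewrite root_matchE // x_i.
    have c_rsrc := sym_sign c_sym c_src; have c_rtgt := sym_sign c_sym c_tgt.
    have := root_uniq n_gt1 i; rewrite /= !inE !negb_or.
    case/and4P=> /and3P[n1 n2 n3] /andP[n4 n5] n6 _.
    move: x_i; rewrite /in_root !inE => /or4P[] /eqP->.
    - by rewrite eqxx c_src.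
    - by rewrite eq_sym (negbTE n1) (negbTE n4) c_tgt.
    - by rewrite eqxx orbT c_rtgt.
    by rewrite eq_sym (negbTE n3) eq_sym (negbTE n6) c_rsrc.
  apply: eq_big => c.
    apply/idP/idP.
      case/andP=> /and3P[m_sym m_par /eqP m_src] /eqP c_eq.
      have c_sym : symclan c by rewrite -c_eq; apply: symclan_unmatch.
      have [c_src c_tgt] := unmatch_signs n_gt1 i (root_match i c).
      rewrite c_eq in c_src c_tgt; rewrite c_sym c_src c_tgt !eqxx !andbT.
      by have [_ <-] := good c c_sym c_src c_tgt.
    case/and4P=> c_sym c_par /eqP c_src /eqP c_tgt.
    by have [-> -> -> ->] := good c c_sym c_src c_tgt; rewrite c_par !eqxx.
  case/andP=> /and3P[m_sym m_par /eqP m_src] /eqP c_eq.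
  have c_sym : symclan c by rewrite -c_eq; apply: symclan_unmatch.
  have [c_src c_tgt] := unmatch_signs n_gt1 i (root_match i c).
  rewrite c_eq in c_src c_tgt.
  rewrite (stat_match n_gt1 c_sym (b := true)) //.
  by rewrite (divnDr _ (dvdnn 8)) addn1 exprS.
congr (_ * _); rewrite -[~~ e]addbT -(head_gf_sign n e false) -[RHS](gf_delete true).
apply: eq_bigl => d; rewrite srcE tgtE.
case: (boolP (symclan d)) => //= d_sym.
case: (d (pos0 n.+1) =P inl true) => [d0|]; last by rewrite andbF.
have -> : parity d = parity (delete_signs d).
  by rewrite -{1}(deleteK d_sym d0) parity_insert.
have -> : d (shift (pos0 n)) = shift_symbol (delete_signs d (pos0 n)).
  by rewrite -{1}(deleteK d_sym d0) insert_shift.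
by case: (delete_signs d (pos0 n)) => // -[].
Qed.

(* Positions are counted from 0, so the middle ones are [n.+2] and [n.+3]:
   [n.+2] is reached from [n.+1] by an ordinary simple reflection and [n.+3]
   from [n.+1] by the branching one. *)
Lemma head_gf_next n e (k k' : position n.+3) :
  [|| (0 < k < n.+2) && (k' == k.+1 :> nat),
      (k == n.+1 :> nat) && (k' == n.+3 :> nat)
    | (n.+3 <= k) && (k.+2 < n.+3 + n.+3) && (k' == k.+1 :> nat)]%N ->
  head_gf n.+2 e (inr k') = 'X * head_gf n.+2 e (inr k).
Proof.
have n_gt1 : (1 < n.+3)%N by [].
have simple0 (i : 'I_n.+3) : (0 < src i)%N -> (tgt i < n.+3 + n.+2)%N ->
    simple i (pos0 n.+2) = pos0 n.+2.
  move=> src_gt0 tgt_lt; apply: simple_id => //.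
  have := root_val n_gt1 i; rewrite /in_root !inE -!val_eqE /= => root_i.
  by case: root_i => -[] *; lia.
case/or3P=> [/andP[/andP[k_gt0 k_n] /eqP k'_eq]|/andP[/eqP k_eq /eqP k'_eq]
            |/andP[/andP[n_k k_m] /eqP k'_eq]].
- have i_n : (k < n.+3)%N by lia.
  have [[_ s_val t_val]|[]] := root_val n_gt1 (Ordinal i_n); last by rewrite /=; lia.
  apply: (@head_gf_simple _ _ (Ordinal i_n)) => //.
    by apply: simple0; rewrite ?s_val ?t_val /=; lia.
  rewrite !inE !xpair_eqE -!val_eqE /=; apply/orP; left.
  by rewrite s_val t_val k'_eq /= !eqxx.
- have [[]|[_ s_val t_val]] := root_val n_gt1 (@ord_max n.+2); first by rewrite /=; lia.
  apply: (@head_gf_simple _ _ ord_max) => //.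
    by apply: simple0; rewrite ?s_val ?t_val /=; lia.
  rewrite !inE !xpair_eqE -!val_eqE /=; apply/orP; left.
  by rewrite s_val t_val k_eq k'_eq; apply/andP; split; apply/eqP; lia.
have i_n : (n.+3 + n.+3 - k.+2 < n.+3)%N by lia.
have [[_ s_val t_val]|[]] := root_val n_gt1 (Ordinal i_n); last by rewrite /=; lia.
apply: (@head_gf_simple _ _ (Ordinal i_n)) => //.
  by apply: simple0; rewrite ?s_val ?t_val /=; lia.
rewrite !inE !xpair_eqE -!val_eqE /=; apply/orP; right.
by rewrite s_val t_val k'_eq /=; apply/andP; split; apply/eqP; lia.
Qed.

Lemma sum_head_gf n e (E := class_gf n.+1 (~~ e)) :
  \sum_(q : position n.+3) head_gf n.+2 e (inr q)
    = (\sum_(1 <= k < n.+2) 'X^k + 2 * 'X^(n.+2)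
       + \sum_(n.+3 <= k < (n.+3 + n).+1) 'X^k) * E.
Proof.
pose tau k := head_gf n.+2 e (inr (insubd (pos0 n.+2) k)).
have insubdE k : (k < n.+3 + n.+3)%N -> insubd (pos0 n.+2) k = k :> nat.
  by move=> k_m; rewrite val_insubd k_m.
have tau1 : tau 1 = 'X * E.
  rewrite -head_gf_match /tau; congr (head_gf _ _ (inr _)).
  by apply: val_inj; rewrite /= insubdE.
have low k : (k < n.+2)%N -> tau k.+1 = 'X^(k.+1) * E.
  elim: k => [|k IHk] k_n; first by rewrite tau1 expr1.
  rewrite exprS -mulrA -IHk; last by lia.
  by apply: head_gf_next; rewrite !insubdE; lia.
(* The case [k = 0] comes from the branching reflection at [n.+1], so position [n.+3] has the same
   exponent as [n.+2]; from there on exponents lag one behind positions. *)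
have high k : (k < n.+2)%N -> tau (n.+3 + k)%N = 'X^(n.+2 + k) * E.
  elim: k => [|k IHk] k_n.
    rewrite !addn0 exprS -mulrA -low //.
    by apply: head_gf_next; rewrite !insubdE; lia.
  rewrite !addnS exprS -mulrA -IHk; last by lia.
  by apply: head_gf_next; rewrite !insubdE; lia.
have -> : \sum_(q : position n.+3) head_gf n.+2 e (inr q)
          = \sum_(0 <= k < n.+3 + n.+3) tau k.
  by rewrite big_mkord; apply: eq_bigr => q _; rewrite /tau; congr (head_gf _ _ (inr _));
    apply: val_inj; rewrite /= insubdE.
have tau0 : tau 0 = 0.
  by apply: head_gf_bad; rewrite -!val_eqE /= insubdE.
have tau_last : tau (n.+3 + n.+2)%N = 0.
  apply: head_gf_bad; rewrite -!val_eqE /= insubdE; lia.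
rewrite (_ : n.+3 + n.+3 = (n.+3 + n.+2).+1)%N; last by lia.
rewrite big_nat_recr //= tau_last addr0 (@big_cat_nat _ _ _ n.+3) //=; last by lia.
rewrite big_nat_recl // tau0 add0r.
rewrite (eq_big_nat _ _ (F2 := fun k => 'X^(k.+1) * E)) => [|k /andP[_ /low]//].
rewrite [X in _ + X](eq_big_nat _ _ (F2 := fun k => 'X^(k.-1) * E)); last first.
  move=> k /andP[le_k lt_k]; have -> : k = (n.+3 + (k - n.+3))%N by lia.
  by rewrite high //; lia.
rewrite -!big_distrl -mulrDl /=; congr (_ * _).
(* The last term of the lower range and the first of the upper one are both ['X^(n.+2)], whence the
   coefficient 2. *)
rewrite big_nat_recr // big_add1 [X in _ = X + _ + _]big_add1 /= addnS /=.
rewrite [X in _ + X = _]big_ltn; last by lia.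
by rewrite addnS mulr_natl mulr2n !addrA.
Qed.

End GeneratingFunctions.

(** * The recurrence for the rank polynomials *)

Local Open Scope ring_scope.

Theorem theorem4p10 (n : nat) (n_ge3 : (3 <= n)%N) :
  A n = 2 * A (n - 1)
        + (\sum_(1 <= k < (n - 2).+1) 'X^k
           + 2 * 'X^(n - 1)
           + \sum_(n <= k < (2 * n - 3).+1) 'X^k) * A (n - 2).
Proof.
case: n n_ge3 => [|[|[|n]]] // _; have -> : (2 * n.+3 - 3 = n.+3 + n)%N by lia.
rewrite !subSS !subn0.
(* The two initial signs give the two parity classes of the next smaller size, which have equal
   generating functions; initial numbers are summed by [sum_head_gf]. *)
rewrite !A_class_gf // class_gf_head big_sumType /= big_bool /= !head_gf_sign /=.
rewrite class_gf_flip // sum_head_gf /= class_gf_flip //.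
by congr (_ + _); rewrite GRing.mulr_natl GRing.mulr2n.
Qed.
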